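(* Let $K$ be a function field in one variable whose constant field $F$ is algebraic over a finite field of characteristic $p>0$, and let $t\in K\setminus F$ not be a $p$-th power in $K$. Then the set $p(K,t)=\{x\in K:\exists s\in\mathbb{Z}_{>0},\ x=t^{p^s}\}$ is first-order definable in $K$.
   Context: ''First-order definable in $K$'' means definable in the language of rings with finitely many parameters from $K$. *)

(* Defs.v *)
From HB Require Import structures.
From mathcomp Require Import all_boot all_order all_algebra.
Set Implicit Arguments. Unset Strict Implicit. Unset Printing Implicit Defensive.
Import GRing.Theory.
Local Open Scope ring_scope.

Definition is_subfield (K : fieldType) (F : {pred K}) : Prop :=
  [/\ 1 \in F,
      (forall x y, x \in F -> y \in F -> x - y \in F),
      (forall x y, x \in F -> y \in F -> x * y \in F) &
      (forall x, x \in F -> x^-1 \in F)].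

Definition algebraic_over (K : fieldType) (F : {pred K}) (x : K) : Prop :=
  exists q : {poly K}, [/\ q != 0, q \is a polyOver F & root q x].

Definition transcendental_over (K : fieldType) (F : {pred K}) (z : K) : Prop :=
  ~ algebraic_over F z.

Definition in_rat_fun_field (K : fieldType) (F : {pred K}) (z x : K) : Prop :=
  exists a b : {poly K}, [/\ a \is a polyOver F, b \is a polyOver F,
                            b.[z] != 0 & x = a.[z] / b.[z]].

Definition function_field_one_var (K : fieldType) (F : {pred K}) : Prop :=
  [/\ is_subfield F,
      (forall x, algebraic_over F x -> x \in F) &
      exists z : K, transcendental_over F z /\
        exists s : seq K, forall x : K, exists c : seq K,
          [/\ size c = size s, (forall i, in_rat_fun_field F z c`_i) &
              x = \sum_(i < size s) c`_i * s`_i]].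

(* x is algebraic over the prime subfield of K (coefficients in the
   image of nat). Given char p > 0, a field is algebraic over a finite
   field iff it is algebraic over its prime field F_p. *)
Definition algebraic_over_prime_field (K : fieldType) (x : K) : Prop :=
  exists q : {poly K}, [/\ q != 0, (forall i, exists n : nat, q`_i = n%:R)
                         & root q x].

(* First-order definability in the language of rings with parameters from K:
   a first-order ring formula (constants from K allowed) in the free
   variable 'X_0 whose satisfying assignments are exactly S. *)
Definition fo_definable (K : fieldType) (S : K -> Prop) : Prop :=
  exists f : GRing.formula K, forall x : K, GRing.holds [:: x] f <-> S x.

(* Main.v *)
Require Import Defs.
From HB Require Import structures.
From mathcomp Require Import all_boot all_order all_algebra.
From mathcomp Require Import boolp zify ring.
Import GRing.Theory.
Local Open Scope ring_scope.
Set Implicit Arguments. Unset Strict Implicit. Unset Printing Implicit Defensive.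

(** Let [h x = [K : F(x)]] (and [h x = 0] for [x] in [F]).  It satisfies
    [h (x y) <= h x + h y], [h (1/x) = h x] and [h (u^q - u) >= q h u], and the
    derivation [D = d/dt] of [K = K^p[t]] satisfies [h (D u) <= C h u] with [C]
    depending on [t] only.  For a large power [q = p^r], suppose that [y] is not
    a [p]-th power and that [y - t = u^q - u] and
    [y^(p+1) - t^(p+1) = v^q - v].  Then [h u] and [h v] are at most about
    [h y / q], so that the height of
    [y^p = D (y^(p+1)) / D y = (t^p - D v) / (1 - D u)] is at most [h y] plus a
    constant; it is at least [p h y], so [h y] is bounded independently of [q].
    For [q] large, [u] and [v] then have height less than [1], i.e., are
    constants, which forces [y = t].  A similar argument excludes that [y^(p^j)]
    satisfies both equations for some [0 < j < r].  As the equations are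
    preserved by extraction of [q]-th roots, their only solutions are the
    [t^(q^k)], and every [t^(p^s)] is the [p^i]-th power of one, with [i < r]. *)

(** * Independence and spanning up to denominators *)

Section Independence.

Variable K : fieldType.

(** Independence over the image of [phi]. The conclusion concerns the values [phi (a i)] rather than
    the [a i], since [phi] may have a kernel, as [ev2 x y] does when [x] and [y] are related. *)
Definition indep (R : Type) (phi : R -> K) (I : finType)
    (s : I -> K) : Prop :=
  forall a : I -> R, \sum_i phi (a i) * s i = 0 -> forall i, phi (a i) = 0.

(* Every finite family of values of [phi] lies, after rescaling by a common
   nonzero factor, in the [psi]-span of [f]; the factor spares us denominators. *)
Definition absorbs (R S : Type) (phi : R -> K) (psi : S -> K)
    (J : finType) (f : J -> K) : Prop :=
  forall (I : finType) (a : I -> R), exists w : K, w != 0 /\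
  exists A : I -> J -> S, forall i, w * phi (a i) = \sum_j psi (A i j) * f j.

(** Padding with zero columns makes the matrix square of determinant zero, and this yields a kernel
    vector over the domain itself, without passing to fractions. *)
Lemma kernel_vector (R : idomainType) (I J : finType) (A : I -> J -> R) :
  (#|J| < #|I|)%N ->
  exists2 c : I -> R, (exists i, c i != 0) & forall j, \sum_i c i * A i j = 0.
Proof.
move=> ltJI.
pose M : 'M[R]_#|I| := \matrix_(i, k)
  (if insub (val k) is Some j then A (enum_val i) (@enum_val J predT j) else 0).
have det0 : \det M == 0.
  rewrite (expand_det_col M (Ordinal ltJI)) big1 // => i _.
  by rewrite mxE /= insubF ?ltnn // mul0r.
case/det0P: det0 => v v_neq0 vM0; exists (fun i => v 0 (enum_rank i)).
  by have [k vk] := rV0Pn _ v_neq0; exists (enum_val k); rewrite enum_valK.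
move=> j; have lt_j : (enum_rank j < #|I|)%N by exact: ltn_trans (ltn_ord _) ltJI.
move/rowP/(_ (Ordinal lt_j)): vM0; rewrite !mxE => vM; rewrite -[RHS]vM.
rewrite (reindex (@enum_val I predT)) /=; last first.
  by apply: onW_bij; exact: enum_val_bij.
apply: eq_bigr => i _; rewrite enum_valK !mxE; congr (_ * _).
by rewrite insubT //= => lt_j'; rewrite (_ : Sub _ _ = enum_rank j) ?enum_rankK //; apply: val_inj.
Qed.

Lemma indep_card (R : idomainType) (phi : {rmorphism R -> K})
    (I J : finType) (s : I -> K) (f : J -> K) :
  injective phi -> absorbs (@id K) phi f -> indep phi s -> (#|I| <= #|J|)%N.
Proof.
move=> inj_phi abs ind; rewrite leqNgt; apply/negP => ltJI.
have [w [w0 [A eqA]]] := abs _ s.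
have [c [i ci0] cA] := kernel_vector A ltJI.
case/negP: ci0; apply/eqP; apply: inj_phi; rewrite rmorph0; apply: (ind c).
apply: (mulfI w0); rewrite mulr0 mulr_sumr.
transitivity (\sum_i \sum_j phi (c i * A i j) * f j).
  apply: eq_bigr => k _; rewrite mulrCA eqA mulr_sumr.
  by apply: eq_bigr => j _; rewrite rmorphM mulrA.
rewrite exchange_big /= big1 // => j _.
by rewrite -mulr_suml -rmorph_sum cA rmorph0 mul0r.
Qed.

(** The tower argument: products of the two generating families generate. The second hypothesis is
    applied to all coefficients [A i j] at once, so that one factor serves them all. *)
Lemma absorbs_trans (R S : Type) (T : nzRingType) (phi : R -> K) (psi : S -> K)
    (chi : {rmorphism T -> K}) (J L : finType) (f : J -> K) (g : L -> K) :
  absorbs phi psi f -> absorbs psi chi g ->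
  absorbs phi chi (fun jl : J * L => f jl.1 * g jl.2).
Proof.
move=> abs1 abs2 I a; have [w [w0 [A eqA]]] := abs1 _ a.
have [v [v0 [B eqB]]] := abs2 _ (fun ij : I * J => A ij.1 ij.2).
exists (v * w); split; first by rewrite mulf_neq0.
exists (fun i jl => B (i, jl.1) jl.2) => i.
rewrite -mulrA eqA mulr_sumr -(pair_bigA _ (fun j l => chi (B (i, j) l) * (f j * g l))) /=.
apply: eq_bigr => j _; rewrite mulrA (eqB (i, j)) mulr_suml.
by apply: eq_bigr => l _; rewrite -mulrA (mulrC (g l)).
Qed.

(** Asking for every large exponent [k] lets a finite family share one power of [w], namely the one
    with the maximal exponent. *)
Lemma absorbs_pow (R S : Type) (phi : R -> K) (psi : S -> K)
    (J : finType) (f : J -> K) (w : K) : w != 0 ->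
  (forall a, exists k0, forall k, (k0 <= k)%N ->
     exists c : J -> S, w ^+ k * phi a = \sum_j psi (c j) * f j) ->
  absorbs phi psi f.
Proof.
move=> w0 H I a.
have [k0 Hk0] := fin_all_exists (fun i => H (a i)).
exists (w ^+ \max_i k0 i); split; first by rewrite expf_neq0.
by have [A HA] := fin_all_exists (fun i => Hk0 i _ (leq_bigmax i)); exists A.
Qed.

Lemma absorbs_unit (R S : Type) (phi : R -> K) (psi : S -> K) (w : K) :
  w != 0 ->
  (forall a, exists k0, forall k, (k0 <= k)%N -> exists c, w ^+ k * phi a = psi c) ->
  absorbs phi psi (fun _ : unit => 1).
Proof.
move=> w0 H; apply: (absorbs_pow w0) => a; have [k0 Hk] := H a.
exists k0 => k /Hk[c ->]; exists (fun=> c).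
by rewrite (eq_bigr (fun=> psi c)) ?sumr_const ?card_unit // => i _; rewrite mulr1.
Qed.

Lemma absorbs_of_fractions (R : nzRingType) (phi : {rmorphism R -> K})
    (J : finType) (f : J -> K) :
  (forall x, exists b (a : J -> R), phi b != 0 /\ phi b * x = \sum_j phi (a j) * f j) ->
  absorbs (@id K) phi f.
Proof.
move=> frac I x; have [b bP] := fin_all_exists (fun i => frac (x i)).
have [a /all_and2[b0 eqb]] := fin_all_exists bP.
exists (\prod_i phi (b i)); split; first by apply/prodf_neq0.
exists (fun i j => (\prod_(k | k != i) b k) * a i j) => i.
rewrite (bigD1 i) //= mulrC mulrA (mulrC (x i)) eqb mulr_suml.
apply: eq_bigr => j _; rewrite rmorphM rmorph_prod mulrAC; congr (_ * _); exact: mulrC.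
Qed.

(** Adding any element to an independent family of maximal length creates a relation, which
    expresses a nonzero multiple of that element through the family. *)
Lemma maximal_indep (R : nzRingType) (phi : {rmorphism R -> K}) (B : nat) :
  (forall n (s : 'I_n -> K), indep phi s -> (n <= B)%N) ->
  exists m (e : 'I_m -> K), indep phi e /\ absorbs (@id K) phi e.
Proof.
move=> bound.
pose P n := `[< exists s : 'I_n -> K, indep phi s >].
have exP : exists n, P n.
  by exists 0%N; apply/asboolP; exists (fun _ => 0) => a _ [].
have ubP n : P n -> (n <= B)%N by move/asboolP=> [s]; exact: bound.
case: (ex_maxnP exP ubP) => m /asboolP[e ind] max; exists m, e; split => //.
apply: absorbs_of_fractions => r.
pose s (i : 'I_m.+1) := if unlift ord0 i is Some j then e j else r.
have /asboolPn nind : ~~ `[< indep phi s >].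
  apply/negP => /asboolP inds; suff: P m.+1 by move/max; rewrite ltnn.
  by apply/asboolP; exists s.
have [c [eqc [i ci]]] : exists c, \sum_i phi (c i) * s i = 0 /\ exists i, phi (c i) != 0.
  apply: contrapT => H; apply: nind => c eqc i; apply: contrapT => /eqP ci.
  by apply: H; exists c; split => //; exists i.
move: eqc; rewrite big_ord_recl {1}/s unlift_none.
under eq_bigr do rewrite /s liftK.
(* The coefficient of [r] is nonzero, since otherwise the relation would involve the independent
   family [e] alone. *)
move=> eqc; exists (c ord0), (fun j => - c (lift ord0 j)); split.
  apply/eqP => c00; move: eqc; rewrite c00 mul0r add0r => /(ind (fun j => c (lift ord0 j))) H.
  by move: ci; case: (unliftP ord0 i) => [j ->|->]; rewrite ?c00 ?H eqxx.
move/eqP: eqc; rewrite addr_eq0 => /eqP ->; rewrite -sumrN.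
by apply: eq_bigr => j _; rewrite rmorphN mulNr.
Qed.

End Independence.

(** * Relations between two elements *)

Section Gauss.

Variable F : fieldType.
Implicit Types (pi c : {poly F}) (P Q R : {poly {poly F}}).

Lemma irreducible_dvdp_exists c :
  (1 < size c)%N -> exists2 pi, irreducible_poly pi & pi %| c.
Proof.
have [n] := ubnP (size c); elim: n c => // n IHn c; rewrite ltnS => le_c_n c1.
have [irr|] := pselect (irreducible_poly c); first by exists c.
move=> nirr; have [q [q1 qc qNc]] : exists q : {poly F}, [/\ size q != 1, q %| c & ~~ (q %= c)].
  apply: contrapT => H; apply: nirr; split => // q q1 qc.
  by apply: contrapT => /negP qNc; apply: H; exists q.
have c0 : c != 0 by rewrite -size_poly_gt0 ltnW.
have q0 : q != 0 by apply: contraTneq qc => ->; rewrite dvd0p.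
have lt_qc : (size q < size c)%N.
  by rewrite ltn_neqAle dvdp_leq // andbT; apply: contraNneq qNc => E; rewrite -dvdp_size_eqp // E.
have [||pi irr piq] := IHn q; first exact: leq_trans le_c_n.
  by case: (size q) q1 (size_poly_eq0 q) => [|[|m]] //; rewrite (negPf q0).
by exists pi => //; apply: dvdp_trans qc.
Qed.

Lemma scale_of_dvdp_coefs pi P : (forall i, pi %| P`_i) -> exists Q, P = pi *: Q.
Proof.
move=> dvd; exists (\poly_(i < size P) (P`_i %/ pi)); apply/polyP => i.
rewrite coefZ coef_poly; case: ltnP => [_|le]; first by rewrite mulrC divpK.
by rewrite mulr0 nth_default.
Qed.

(** If [i] and [j] are the least indices of coefficients of [Q] and [P] not divisible by [pi], then
    the coefficient of index [i + j] of the product has exactly one term not divisible by [pi]. *)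
Lemma dvdp_coefs_mul pi P Q : irreducible_poly pi -> (forall i, pi %| (Q * P)`_i) ->
  (forall i, pi %| Q`_i) \/ (forall i, pi %| P`_i).
Proof.
move=> irr dvdQP; apply: contrapT => /not_orP[/existsNP exQ /existsNP exP].
have {}exQ : exists i, ~~ (pi %| Q`_i) by have [i /negP] := exQ; exists i.
have {}exP : exists i, ~~ (pi %| P`_i) by have [i /negP] := exP; exists i.
case: (ex_minnP exQ) => i Qi minQ; case: (ex_minnP exP) => j Pj minP.
have := dvdQP (i + j)%N; rewrite coefM.
have ltij : (i < (i + j).+1)%N by rewrite ltnS leq_addr.
rewrite (bigD1 (Ordinal ltij)) //= [(i + j - i)%N]addKn dvdp_addl.
  rewrite Gauss_dvdpr ?irreducible_poly_coprime //; exact/negP.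
apply: (big_ind (fun a => pi %| a)); [exact: dvdp0|by move=> a b; exact: dvdp_add|].
move=> k; rewrite -val_eqE /= => kNi; have [ltki|leik] := ltnP k i.
  apply: dvdp_mulr; apply: contraTT ltki; rewrite -leqNgt; exact: minQ.
apply: dvdp_mull; apply: contraTT isT => /minP; have := ltn_ord k; lia.
Qed.

(** Since [P] is primitive, each irreducible factor of [c] divides all coefficients of [Q] and can
    be cancelled; only a nonzero constant remains. *)
Lemma cancel_content c P Q R : c != 0 ->
  (forall pi, irreducible_poly pi -> ~ forall i, pi %| P`_i) ->
  c *: R = Q * P -> exists (a : F) Q', a != 0 /\ a%:P *: R = Q' * P.
Proof.
move=> c0 prim; have [n] := ubnP (size c); elim: n c c0 Q => // n IHn c c0 Q.
rewrite ltnS => le_c eqR; have [le1|gt1] := leqP (size c) 1.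
  have := size1_polyC le1 => defc; exists c`_0, Q; rewrite -defc; split=> //.
  by apply: contraNneq c0 => E; rewrite defc E.
have [pi irr /dvdpP[c' defc]] := irreducible_dvdp_exists gt1.
have pi0 := irredp_neq0 irr.
have dvdQP i : pi %| (Q * P)`_i by rewrite -eqR coefZ defc mulrAC dvdp_mulIr.
have [/scale_of_dvdp_coefs[Q' defQ]|] := dvdp_coefs_mul irr dvdQP; last by move/prim => /(_ irr).
have c'0 : c' != 0 by apply: contraNneq c0 => E; rewrite defc E mul0r.
apply: (IHn c' c'0 Q').
  have lt_of_pred (u v w : nat) : (1 < v -> (u + v).-1 <= w -> u < w)%N by lia.
  move: le_c; rewrite defc size_mul //; apply: lt_of_pred; exact: irr.1.
apply: (@mulfI _ pi%:P); first by rewrite polyC_eq0.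
by rewrite mulrA !mul_polyC -defQ -eqR defc mulrC scalerA.
Qed.

End Gauss.

(** * Evaluation at one or two elements of [K], and minimal relations *)

Section Evaluation.

Variables (F K : fieldType) (iota : {rmorphism F -> K}).
Implicit Types (x y z : K) (a : {poly F}) (P Q R : {poly {poly F}}).

Definition ev x a : K := (map_poly iota a).[x].
HB.instance Definition _ x :=
  GRing.RMorphism.copy (ev x) (horner_eval x \o map_poly iota).

(* The outer variable is sent to [y], the coefficients are evaluated at [x]. *)
Definition ev2 x y P : K := (map_poly (ev x) P).[y].
HB.instance Definition _ x y :=
  GRing.RMorphism.copy (ev2 x y) (horner_eval y \o map_poly (ev x)).

Definition transc x : Prop := forall a, ev x a = 0 -> a = 0.

Lemma evE x a : ev x a = (map_poly iota a).[x]. Proof. by []. Qed.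
Lemma ev2E x y P : ev2 x y P = (map_poly (ev x) P).[y]. Proof. by []. Qed.
Lemma evC x (c : F) : ev x c%:P = iota c.
Proof. by rewrite evE map_polyC hornerC. Qed.
Lemma evX x : ev x 'X = x. Proof. by rewrite evE map_polyX hornerX. Qed.
Lemma ev2C x y a : ev2 x y a%:P = ev x a.
Proof. by rewrite ev2E map_polyC hornerC. Qed.
Lemma ev2X x y : ev2 x y 'X = y. Proof. by rewrite ev2E map_polyX hornerX. Qed.
Lemma ev2Z x y a P : ev2 x y (a *: P) = ev x a * ev2 x y P.
Proof. by rewrite -mul_polyC rmorphM /= ev2C. Qed.

Lemma ev_sum x a n : (size a <= n)%N -> ev x a = \sum_(i < n) iota a`_i * x ^+ i.
Proof.
move=> le; rewrite evE (@horner_coef_wide _ n) ?size_map_poly //.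
by apply: eq_bigr => i _; rewrite coef_map.
Qed.

Lemma ev2_sum x y P n : (size P <= n)%N ->
  ev2 x y P = \sum_(i < n) ev x P`_i * y ^+ i.
Proof.
move=> le; rewrite ev2E (@horner_coef_wide _ n); last exact: leq_trans (size_poly _ _) le.
by apply: eq_bigr => i _; rewrite coef_map.
Qed.

Lemma ev2_swap x y P : ev2 x y (swapXY P) = ev2 y x P.
Proof.
elim/poly_ind: P => [|P c IH]; first by rewrite !rmorph0.
rewrite !rmorphD !rmorphM /= IH swapXY_X swapXY_polyC ev2C evX ev2X ev2C; congr (_ + _).
elim/poly_ind: c => [|c d IHc]; first by rewrite !rmorph0.
by rewrite !rmorphD !rmorphM /= IHc map_polyX ev2X evX map_polyC ev2C !evC.
Qed.

Lemma ev_inj x : transc x -> injective (ev x).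
Proof.
move=> tx a b /eqP; rewrite -subr_eq0 -rmorphB => /eqP/tx/eqP.
by rewrite subr_eq0 => /eqP.
Qed.

Lemma ev_neq0 x a : transc x -> a != 0 -> ev x a != 0.
Proof. by move=> tx; apply: contraNneq => /tx ->. Qed.

(** Minimize the degree in the outer variable first, then the degree in the inner one. The result is
    primitive, hence by Gauss's lemma divides every relation up to a constant, which makes both
    degrees minimal simultaneously. *)
Lemma minimal_relation x y : transc x -> (exists2 P, P != 0 & ev2 x y P = 0) ->
  exists P, [/\ P != 0, ev2 x y P = 0 &
    forall R, R != 0 -> ev2 x y R = 0 -> (size P <= size R)%N /\ (sizeY P <= sizeY R)%N].
Proof.
move=> tx [P0 P0n0 P00].
pose rel P := P != 0 /\ ev2 x y P = 0.
pose S n := `[< exists P, rel P /\ size P = n >].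
have exS : exists n, S n by exists (size P0); apply/asboolP; exists P0.
case: (ex_minnP exS) => n /asboolP[P1 [relP1 sP1]] minS.
pose T m := `[< exists P, [/\ rel P, size P = n & sizeY P = m] >].
have exT : exists m, T m by exists (sizeY P1); apply/asboolP; exists P1.
case: (ex_minnP exT) => m /asboolP[P [[Pn0 P00'] sP sYP]] minT.
have minP R : rel R -> (size P <= size R)%N.
  by move=> relR; rewrite sP; apply: minS; apply/asboolP; exists R.
exists P; split=> // R Rn0 R0; split; first exact: minP.
have cn0 : lead_coef P != 0 by rewrite lead_coef_eq0.
have := Pdiv.ComRing.rdivp_eq P R.
set c := _ ^+ _; set Q := Pdiv.Ring.rdivp _ _; set U := Pdiv.Ring.rmodp _ _ => eqR.
(* The pseudo-remainder is again a relation, too small to be nonzero. *)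
have U0 : U = 0.
  apply: contrapT => /eqP Un0.
  have : (size P <= size U)%N.
    apply: minP; split=> //; have /eqP := congr1 (ev2 x y) eqR.
    by rewrite ev2Z R0 mulr0 rmorphD rmorphM /= P00' mulr0 add0r => /eqP ->.
  by rewrite leqNgt Pdiv.Ring.ltn_rmodp Pn0.
rewrite U0 addr0 in eqR.
have [||a [Q' [an0 eqaR]]] := cancel_content _ _ eqR; first by rewrite expf_neq0.
  (* Dividing out [pi] would leave a relation of the same size, as [ev x pi] is nonzero, but of
     smaller [sizeY]. *)
  move=> pi irr /scale_of_dvdp_coefs[P' defP].
  have pi0 := irredp_neq0 irr.
  have P'n0 : P' != 0 by apply: contraNneq Pn0 => E; rewrite defP E scaler0.
  have /minT : T (sizeY P').
    apply/asboolP; exists P'; split=> //; last by rewrite -sP defP size_scale.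
    split=> //; have /eqP := P00'; rewrite defP ev2Z mulf_eq0.
    by rewrite (negPf (ev_neq0 tx pi0)) => /eqP.
  rewrite -sYP defP !sizeYE -mul_polyC rmorphM /= swapXY_polyC.
  rewrite size_mul ?swapXY_eq0 ?map_polyC_eq0 // size_map_polyC.
  have absurd (u v : nat) : (0 < v -> 1 < u -> (u + v).-1 <= v -> False)%N by lia.
  by apply: absurd irr.1; rewrite size_poly_gt0 swapXY_eq0.
have Q'n0 : Q' != 0.
  apply: contra_neq Rn0 => E; move/eqP: eqaR.
  by rewrite E mul0r -mul_polyC mulf_eq0 !polyC_eq0 (negPf an0) => /eqP.
move/(congr1 (fun P => size (swapXY P))): eqaR.
rewrite -mul_polyC !rmorphM /= swapXY_polyC map_polyC !size_mul ?swapXY_eq0 ?polyC_eq0 //.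
rewrite size_polyC polyC_eq0 an0 /= -!sizeYE add0n => ->.
have : (0 < sizeY Q')%N by rewrite lt0n sizeY_eq0.
by case: (sizeY Q') => // k _; rewrite addSn /= leq_addl.
Qed.

End Evaluation.

(** The powers [X^j] with [j < deg g] are independent over [F[g]]. Splitting off the constant terms
    of the [a j] writes the sum as [A * g + C] with [deg C < deg g]; hence [A] and [C] vanish, and
    the induction continues with [A]. *)
Lemma comp_poly_expansion_eq0 (F : fieldType) (g : {poly F})
    (a : 'I_(size g).-1 -> {poly F}) :
  \sum_j (a j \Po g) * 'X^j = 0 -> forall j, a j = 0.
Proof.
have [n] := ubnP (\max_j size (a j)); elim: n a => // n IHn a; rewrite ltnS => le_n sum0.
have [g0 j|gn0] := eqVneq g 0.
  by case: j => j /= lt; exfalso; rewrite g0 size_poly0 in lt.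
have dec j : a j = drop_poly 1 (a j) * 'X + ((a j)`_0)%:P.
  rewrite -{1}(poly_take_drop 1 (a j)) addrC; congr (_ + _).
  by apply/polyP => -[|i]; rewrite coef_take_poly coefC.
pose A := \sum_j (drop_poly 1 (a j) \Po g) * 'X^j.
pose C := \sum_j (a j)`_0 *: 'X^j : {poly F}.
have split0 : A * g + C = 0.
  rewrite -sum0 mulr_suml -big_split; apply: eq_bigr => j _ /=.
  rewrite {3}(dec j) comp_polyD comp_polyM comp_polyX comp_polyC mulrDl mul_polyC.
  by rewrite -!mulrA (mulrC g).
have sC : (size C < size g)%N.
  rewrite -(prednK (_ : 0 < size g)%N) ?size_poly_gt0 // ltnS.
  apply: leq_trans (size_sum _ _ _) _; apply/bigmax_leqP => j _.
  by apply: leq_trans (size_scale_leq _ _) _; rewrite size_polyXn.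
have A0 : A = 0.
  apply: contrapT => /eqP An0; move/eqP: split0; rewrite addr_eq0 => /eqP eqA.
  have absurd (u v : nat) : (0 < u -> (u + v).-1 < v -> False)%N by lia.
  by move: sC; rewrite -size_polyN -eqA size_mul //; apply: absurd; rewrite size_poly_gt0.
move: split0; rewrite A0 mul0r add0r => C0 j; have cj0 : (a j)`_0 = 0.
  have := congr1 (fun q : {poly F} => q`_j) C0; rewrite coef0 coef_sum => sumC; rewrite -[RHS]sumC.
  rewrite (bigD1 j) //= coefZ coefXn eqxx mulr1 big1 ?addr0 // => i iNj.
  by rewrite coefZ coefXn eq_sym (inj_eq val_inj) (negPf iNj) mulr0.
rewrite (dec j) cj0; have [max0|max_gt0] := posnP (\max_j size (a j)).
  have := leq_bigmax (F := fun j => size (a j)) j; rewrite max0 leqn0 size_poly_eq0.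
  by move=> /eqP ->; rewrite raddf0 mul0r addr0.
rewrite addr0 (IHn (fun j => drop_poly 1 (a j))) ?mul0r //.
apply: leq_trans _ le_n; rewrite -(prednK max_gt0) ltnS.
apply/bigmax_leqP => i _; rewrite size_drop_poly -subn1 leq_sub2r //.
exact: (leq_bigmax (F := fun j => size (a j))).
Qed.

(** * Spanning and independence over [F[x]] and [F[x, y]] *)

Section Spanning.

Variables (F K : fieldType) (iota : {rmorphism F -> K}).
Implicit Types (x y z : K) (a g : {poly F}) (P Q R : {poly {poly F}}).
Local Notation ev := (ev iota).
Local Notation ev2 := (ev2 iota).
Local Notation transc := (transc iota).

Lemma ev_comp x a g : ev x (a \Po g) = ev (ev x g) a.
Proof. by rewrite /ev map_comp_poly horner_comp. Qed.

(** Pseudo-division by [P] reduces every polynomial in [y] below the degree of [P], at the cost of a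
    power of the leading coefficient. *)
Lemma absorbs_relation x y P : transc x -> P != 0 -> ev2 x y P = 0 ->
  absorbs (ev2 x y) (ev x) (fun j : 'I_(size P).-1 => y ^+ j).
Proof.
move=> tx Pn0 P0; apply: (@absorbs_pow _ _ _ _ _ _ _ (ev x (lead_coef P))).
  by apply: ev_neq0; rewrite ?lead_coef_eq0.
move=> A; exists (Pdiv.Ring.rscalp A P) => k le_k.
have := Pdiv.ComRing.rdivp_eq P A.
set Q := Pdiv.Ring.rdivp _ _; set U := Pdiv.Ring.rmodp _ _ => eqA.
exists (fun j : 'I_(size P).-1 => lead_coef P ^+ (k - Pdiv.Ring.rscalp A P) * U`_j).
have sU : (size U <= (size P).-1)%N.
  by rewrite -ltnS prednK ?size_poly_gt0 // Pdiv.Ring.ltn_rmodp.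
have := congr1 (ev2 x y) eqA; rewrite ev2Z rmorphD rmorphM /= P0 mulr0 add0r.
rewrite (ev2_sum _ _ _ sU) rmorphXn => eqU.
rewrite -(subnK le_k) exprD -mulrA eqU mulr_sumr; apply: eq_bigr => j _.
by rewrite addnK rmorphM rmorphXn mulrA.
Qed.

Lemma absorbs_ev_ev2 x y : absorbs (ev y) (ev2 x y) (fun _ : unit => 1).
Proof.
apply: (@absorbs_unit _ _ _ _ _ 1); first exact: oner_neq0.
move=> a; exists 0%N => k _; exists (swapXY a%:P).
by rewrite expr1n mul1r ev2_swap ev2C.
Qed.

Lemma absorbs_inv x : x != 0 -> absorbs (ev x) (ev x^-1) (fun _ : unit => 1).
Proof.
move=> x0; apply: (@absorbs_unit _ _ _ _ _ x^-1); first by rewrite invr_eq0.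
move=> a; exists (size a) => k le_k.
exists (\sum_(i < size a) a`_i *: 'X^(k - i)).
rewrite (ev_sum iota x (leqnn _)) mulr_sumr rmorph_sum; apply: eq_bigr => i _ /=.
rewrite -mul_polyC rmorphM rmorphXn /= evC evX mulrCA; congr (_ * _).
have le_ik : (i <= k)%N by apply: leq_trans le_k; exact: ltnW.
by rewrite -{1}(subnK le_ik) exprD -mulrA -exprMn mulVf // expr1n mulr1.
Qed.

(* The homogenization [Y^k A(X, Z/Y)], read with [Z = XY], as a polynomial in
   the outer variable [X] over [F[Z]]. *)
Definition twist (k : nat) P : {poly {poly F}} :=
  swapXY (\poly_(j < size P) (P`_j * 'X^(k - j))).

Lemma ev2_twist x y k P : ((size P).-1 <= k)%N ->
  ev2 (x * y) x (twist k P) = x ^+ k * ev2 x y P.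
Proof.
move=> le_k; rewrite /twist ev2_swap (ev2_sum _ _ _ (size_poly _ _)).
rewrite (ev2_sum _ _ _ (leqnn _)) mulr_sumr; apply: eq_bigr => j _.
rewrite coef_poly ltn_ord rmorphM rmorphXn /= evX exprMn.
rewrite -mulrA [x ^+ (k - j) * _]mulrA -exprD subnK.
  by rewrite mulrCA.
by apply: leq_trans le_k; rewrite -ltnS prednK // (leq_trans _ (ltn_ord j)).
Qed.

Lemma twist_neq0 k P : P != 0 -> twist k P != 0.
Proof.
move=> Pn0; rewrite swapXY_eq0; apply/eqP => /polyP/(_ (size P).-1).
rewrite coef0 coef_poly prednK ?size_poly_gt0 // leqnn => /eqP.
by rewrite mulf_eq0 -lead_coefE lead_coef_eq0 (negPf Pn0) expf_eq0 polyX_eq0 andbF.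
Qed.

Lemma size_twist k P : (size (twist k P) <= sizeY P + k)%N.
Proof.
rewrite /twist -sizeYE; apply/bigmax_leqP => i _; rewrite coef_poly.
case: ifP => _; last by rewrite size_poly0.
apply: leq_trans (size_polyMleq _ _) _; rewrite size_polyXn addnS /=.
by rewrite leq_add ?leq_subr // max_size_coefXY.
Qed.

Lemma absorbs_mul x y : x != 0 ->
  absorbs (ev2 x y) (ev2 (x * y) x) (fun _ : unit => 1).
Proof.
move=> x0; apply: (@absorbs_unit _ _ _ _ _ x) => // A.
by exists (size A).-1 => k le_k; exists (twist k A); rewrite ev2_twist.
Qed.

(** The [B.+1] first powers of [y] are too many to be independent over [F[x]]. *)
Lemma relation_of_bound x y (B : nat) :
  (forall m (s : 'I_m -> K), indep (ev x) s -> (m <= B)%N) ->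
  exists2 P, P != 0 & ev2 x y P = 0.
Proof.
move=> bound; pose s (i : 'I_B.+1) := y ^+ i.
have nind : ~ indep (ev x) s by move/bound; rewrite ltnn.
have [a [suma [i ai]]] : exists a : 'I_B.+1 -> {poly F},
    \sum_i ev x (a i) * s i = 0 /\ exists i, ev x (a i) <> 0.
  apply: contrapT => H; apply: nind => a suma i; apply: contrapT => ai.
  by apply: H; exists a; split=> //; exists i.
exists (\poly_(j < B.+1) a (inord j)).
  apply/eqP => /polyP/(_ i); rewrite coef0 coef_poly ltn_ord inord_val => ai0.
  by apply: ai; rewrite ai0 rmorph0.
rewrite (ev2_sum _ _ _ (size_poly _ _)) -[RHS]suma; apply: eq_bigr => j _.
by rewrite coef_poly ltn_ord inord_val.
Qed.

Lemma indep_eq (R S : Type) (phi : R -> K) (psi : S -> K) (u : S -> R) (I : finType) (s : I -> K) :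
  (forall b, phi (u b) = psi b) -> indep phi s -> indep psi s.
Proof.
move=> E ind a suma i; rewrite -E; apply: (ind (fun i => u (a i))).
by rewrite -[RHS]suma; apply: eq_bigr => j _; rewrite E.
Qed.

Lemma indep_ev2 x y (I : finType) (s : I -> K) :
  indep (ev2 x y) s -> indep (ev x) s.
Proof. by apply: (indep_eq (u := polyC)) => a; exact: ev2C. Qed.

Lemma indep_ev2_swap x y (I : finType) (s : I -> K) :
  indep (ev2 x y) s -> indep (ev2 y x) s.
Proof. by apply: (indep_eq (u := @swapXY F)) => a; exact: ev2_swap. Qed.

(** Minimality of [size P] makes the powers of [y] below the degree of [P] independent over [F[x]];
    the rest is the usual argument for a tower of extensions. *)
Lemma indep_tower x y P (I : finType) (e : I -> K) : transc x ->
  (forall R, R != 0 -> ev2 x y R = 0 -> (size P <= size R)%N) ->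
  indep (ev2 x y) e ->
  indep (ev x) (fun ij : I * 'I_(size P).-1 => e ij.1 * y ^+ ij.2).
Proof.
move=> tx minP ind a suma [i j].
pose A i := \poly_(j < (size P).-1) oapp (fun j => a (i, j)) 0 (insub j).
have evA k : ev2 x y (A k) = \sum_j ev x (a (k, j)) * y ^+ j.
  rewrite (ev2_sum _ _ _ (size_poly _ _)); apply: eq_bigr => l _.
  by rewrite coef_poly ltn_ord insubT //= => lt; congr (ev x (a (k, _)) * _); apply: val_inj.
have A0 : ev2 x y (A i) = 0.
  apply: ind => //; rewrite -[RHS]suma.
  transitivity (\sum_i \sum_j ev x (a (i, j)) * (e i * y ^+ j)); last first.
    by rewrite pair_bigA; apply: eq_bigr => -[k l] _.
  apply: eq_bigr => k _; rewrite evA mulr_suml; apply: eq_bigr => l _.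
  by rewrite mulrA mulrAC.
have Ai0 : A i = 0.
  apply: contrapT => /eqP An0; have := leq_trans (minP _ An0 A0) (size_poly _ _).
  by case: (size P) j => [[]|n _] //=; rewrite ltnn.
move/polyP/(_ j): Ai0; rewrite coef0 coef_poly ltn_ord insubT //= => lt.
by rewrite (_ : Sub _ _ = j) => [->|]; rewrite ?rmorph0 //; apply: val_inj.
Qed.

End Spanning.

(** * Heights *)

Lemma indep_ord (K : fieldType) (R : Type) (phi : R -> K) (I : finType) (s : I -> K) :
  indep phi s -> indep phi (fun k : 'I_#|I| => s (enum_val k)).
Proof.
move=> ind a suma k; rewrite -(enum_valK k); apply: (ind (fun i => a (enum_rank i))).
rewrite -[RHS]suma (reindex (@enum_val I predT)); last first.
  by apply: onW_bij; exact: enum_val_bij.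
by apply: eq_bigr => j _; rewrite enum_valK.
Qed.

Section Height.

Variables (F K : fieldType) (iota : {rmorphism F -> K}).
Implicit Types (x y z : K) (a g : {poly F}) (P Q R : {poly {poly F}}).
Local Notation ev := (ev iota).
Local Notation ev2 := (ev2 iota).
Local Notation transc := (transc iota).

(* [n] is the degree of [K] over [F(x)], set to [0] when [x] is algebraic. *)
Definition is_height x (n : nat) : Prop :=
  (transc x -> (exists s : 'I_n -> K, indep (ev x) s) /\
     forall m (s : 'I_m -> K), indep (ev x) s -> (m <= n)%N) /\
  (~ transc x -> n = 0%N).

Lemma is_height_exists x (B : nat) :
  (transc x -> forall m (s : 'I_m -> K), indep (ev x) s -> (m <= B)%N) ->
  exists n, is_height x n.
Proof.
move=> bound; have [tx|ntx] := pselect (transc x); last by exists 0%N.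
have [m [e [ind abs]]] := maximal_indep (bound tx).
exists m; split=> // _; split; first by exists e.
by move=> n s inds; have := indep_card (ev_inj tx) abs inds; rewrite !card_ord.
Qed.

(** Any transcendental [x] is algebraically related to [z], so that [F(x, z)] is finite over [F(x)];
    as [K] is finite over [F(z)], it is finite over [F(x)] too. *)
Lemma height_exists z (J : finType) (f : J -> K) : transc z ->
  absorbs (@id K) (ev z) f -> forall x, exists n, is_height x n.
Proof.
move=> tz abs x; have [tx|ntx] := pselect (transc x); last by exists 0%N.
have bz m (s : 'I_m -> K) : indep (ev z) s -> (m <= #|J|)%N.
  by move/(indep_card (ev_inj tz) abs); rewrite card_ord.
have [P Pn0 P0] := relation_of_bound x bz.
rewrite -ev2_swap in P0; rewrite -swapXY_eq0 in Pn0.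
have := absorbs_trans abs (absorbs_trans (absorbs_ev_ev2 iota x z)
  (absorbs_relation tx Pn0 P0)).
move=> {}abs; apply: is_height_exists => _ m s inds.
by have := indep_card (ev_inj tx) abs inds; rewrite card_ord; apply.
Qed.

Hypothesis constP : forall x, ~ transc x -> exists c, x = iota c.
Variable h : K -> nat.
Hypothesis hP : forall x, is_height x (h x).

Lemma const_not_transc c : ~ transc (iota c).
Proof.
move/(_ ('X - c%:P)); rewrite rmorphB /= evX evC subrr => /(_ erefl)/eqP.
by rewrite polyXsubC_eq0.
Qed.

Lemma height_const c : h (iota c) = 0%N.
Proof. exact: (hP (iota c)).2 (@const_not_transc c). Qed.

Lemma height_transc x : (0 < h x)%N -> transc x.
Proof. by move=> hx; apply: contrapT => /(hP x).2 E; rewrite E in hx. Qed.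

Lemma card_le_height x (I : finType) (s : I -> K) : transc x ->
  indep (ev x) s -> (#|I| <= h x)%N.
Proof. by move=> tx /indep_ord; apply: ((hP x).1 tx).2. Qed.

Lemma height_le x (J : finType) (f : J -> K) : transc x ->
  absorbs (@id K) (ev x) f -> (h x <= #|J|)%N.
Proof.
move=> tx abs; have [[s inds] _] := (hP x).1 tx.
by have := indep_card (ev_inj tx) abs inds; rewrite card_ord.
Qed.

Lemma height_basis x : transc x ->
  exists e : 'I_(h x) -> K, indep (ev x) e /\ absorbs (@id K) (ev x) e.
Proof.
move=> tx; have [m [e [ind abs]]] := maximal_indep ((hP x).1 tx).2.
suff E : h x = m by rewrite E; exists e.
apply/eqP; rewrite eqn_leq.
have := height_le tx abs; rewrite card_ord => ->.
by have := card_le_height tx ind; rewrite card_ord.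
Qed.

Lemma height_gt0 x : transc x -> (0 < h x)%N.
Proof.
move=> tx; have : indep (ev x) (fun _ : unit => 1).
  move=> a; rewrite (eq_bigr (fun _ => ev x (a tt))) ?sumr_const ?card_unit.
    by move=> eqa [].
  by move=> [] _; rewrite mulr1.
by move/(card_le_height tx); rewrite card_unit.
Qed.

Lemma height_eq0 x : h x = 0%N -> exists c, x = iota c.
Proof. by move=> hx; apply: constP => /height_gt0; rewrite hx. Qed.

(** This reflects [[F(x) : F(g(x))] = deg g]: a basis over [F(x)], multiplied by the [x^j] with
    [j < deg g], is independent over [F(g(x))]. *)
Lemma height_ev x g : ((size g).-1 * h x <= h (ev x g))%N.
Proof.
have [->|gn1] := eqVneq (size g).-1 0%N; first by rewrite mul0n.
have [tx|/(hP x).2 ->] := pselect (transc x); last by rewrite muln0.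
have tgx : transc (ev x g).
  move=> a; rewrite -ev_comp => /tx/eqP; rewrite comp_poly_eq0; first by move/eqP.
  by case: (size g) gn1 => [|[|]].
have [e [ind _]] := height_basis tx.
have : indep (ev (ev x g)) (fun ij : 'I_(h x) * 'I_(size g).-1 => e ij.1 * x ^+ ij.2).
  move=> a suma [i j]; rewrite (_ : a _ = 0) ?rmorph0 //.
  pose A i := \sum_j (a (i, j) \Po g) * 'X^j.
  have evA k : ev x (A k) = \sum_j ev (ev x g) (a (k, j)) * x ^+ j.
    rewrite rmorph_sum; apply: eq_bigr => l _ /=.
    by rewrite rmorphM rmorphXn /= evX ev_comp.
  apply: (@comp_poly_expansion_eq0 _ g (fun j => a (i, j))); apply: tx.
  apply: (ind A); rewrite -[RHS]suma.
  transitivity (\sum_i \sum_j ev (ev x g) (a (i, j)) * (e i * x ^+ j)); last first.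
    by rewrite pair_bigA; apply: eq_bigr => -[k l] _.
  apply: eq_bigr => k _; rewrite evA mulr_suml; apply: eq_bigr => l _.
  by rewrite mulrA mulrAC.
by move/(card_le_height tgx); rewrite card_prod !card_ord mulnC.
Qed.

Lemma height_linear x (c d : F) : c != 0 -> (h x <= h (iota c * x + iota d))%N.
Proof.
move=> cn0; have := height_ev x (c%:P * 'X + d%:P).
rewrite rmorphD rmorphM /= evX !evC size_MXaddC polyC_eq0 (negPf cn0).
by rewrite size_polyC cn0 mul1n.
Qed.

Lemma height_addC x c : h (x + iota c) = h x.
Proof.
apply/eqP; rewrite eqn_leq.
have := height_linear x c (oner_neq0 F); rewrite rmorph1 mul1r => ->; rewrite andbT.
have := height_linear (x + iota c) (- c) (oner_neq0 F).
by rewrite rmorph1 mul1r rmorphN addrK.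
Qed.

Lemma height_mulC x c : (h (iota c * x) <= h x)%N.
Proof.
have [->|cn0] := eqVneq c 0; first by rewrite rmorph0 mul0r -(rmorph0 iota) height_const.
have := height_linear (iota c * x) 0 (invr_neq0 cn0).
by rewrite rmorph0 addr0 mulrA -rmorphM mulVf // rmorph1 mul1r.
Qed.

Lemma height_opp x : h (- x) = h x.
Proof.
have le y : (h (- y) <= h y)%N by have := height_mulC y (- 1); rewrite rmorphN1 mulN1r.
by apply/eqP; rewrite eqn_leq le -{1}(opprK x) le.
Qed.

Lemma transc_inv x : transc x -> transc x^-1.
Proof.
move=> tx; apply: contrapT => /constP[c eqc]; apply: (@const_not_transc c^-1).
by rewrite fmorphV -eqc invrK.
Qed.

Lemma transc_neq0 x : transc x -> x != 0.
Proof. by move=> tx; apply/eqP => x0; apply: (@const_not_transc 0); rewrite rmorph0 -x0. Qed.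

Lemma height_inv x : h x^-1 = h x.
Proof.
suff le y : (h y^-1 <= h y)%N by apply/eqP; rewrite eqn_leq le -{1}(invrK x) le.
have [ty|/constP[c ->]] := pselect (transc y); last by rewrite -fmorphV !height_const.
have [e [_ abs]] := height_basis ty.
have := height_le (transc_inv ty) (absorbs_trans abs (absorbs_inv iota (transc_neq0 ty))).
by rewrite card_prod card_ord card_unit muln1.
Qed.

(** Here [m] is [[K : F(x, y)]], and the two degrees of [P] are those of [F(x, y)] over [F(x)] and
    over [F(y)]. *)
Lemma height_relation x y : transc x -> transc y ->
  exists P, [/\ P != 0, ev2 x y P = 0,
   forall R, R != 0 -> ev2 x y R = 0 -> (size P <= size R)%N /\ (sizeY P <= sizeY R)%N &
   exists m (e : 'I_m -> K), [/\ (0 < m)%N, absorbs (@id K) (ev2 x y) e,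
     (m * (size P).-1 <= h x)%N & (m * (sizeY P).-1 <= h y)%N]].
Proof.
move=> tx ty.
have [P [Pn0 P0 minP]] := minimal_relation tx (relation_of_bound y ((hP x).1 tx).2).
exists P; split=> //.
have bound n (s : 'I_n -> K) : indep (ev2 x y) s -> (n <= h x)%N.
  by move/indep_ev2; apply: ((hP x).1 tx).2.
have [m [e [ind abs]]] := maximal_indep bound.
exists m, e; split=> //.
- case: m {ind} e abs => // e /(_ _ (fun _ : unit => 1))[w [wn0 [A /(_ tt)/eqP]]].
  by rewrite big_ord0 mulr1 (negPf wn0).
- have minP1 R : R != 0 -> ev2 x y R = 0 -> (size P <= size R)%N.
    by move=> Rn0 /(minP _ Rn0)[].
  by have := card_le_height tx (indep_tower tx minP1 ind); rewrite card_prod !card_ord.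
(* The roles of [x] and [y] are exchanged; this is where minimality of [sizeY P] is needed. *)
- have minP2 R : R != 0 -> ev2 y x R = 0 -> (size (swapXY P) <= size R)%N.
  rewrite -swapXY_eq0 -ev2_swap => Rn0 /(minP _ Rn0)[_].
  by rewrite !sizeYE swapXYK.
have := card_le_height ty (indep_tower ty minP2 (indep_ev2_swap ind)).
by rewrite card_prod !card_ord sizeYE.
Qed.

(** The twisted relation bounds the degree of [x] over [F(x * y)] by the sum of the two degrees of
    [P]. Multiplying by [m = [K : F(x, y)]] turns these degrees into heights. *)
Lemma height_mul x y : (h (x * y) <= h x + h y)%N.
Proof.
have [tx|/constP[c ->]] := pselect (transc x); last first.
  by rewrite height_const height_mulC.
have [ty|/constP[c ->]] := pselect (transc y); last first.
  by rewrite height_const addn0 mulrC height_mulC.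
have [txy|/(hP _).2 -> //] := pselect (transc (x * y)).
have [P [Pn0 P0 _ [m [e [_ abs le1 le2]]]]] := height_relation tx ty.
have G0 : ev2 (x * y) x (twist (size P).-1 P) = 0 by rewrite ev2_twist // P0 mulr0.
have := height_le txy (absorbs_trans abs (absorbs_trans (absorbs_mul iota y (transc_neq0 tx))
  (absorbs_relation txy (twist_neq0 _ Pn0) G0))).
rewrite !card_prod !card_ord card_unit mul1n => /leq_trans; apply.
apply: leq_trans (_ : (m * ((size P).-1 + (sizeY P).-1) <= _)%N); last first.
  by rewrite mulnDr leq_add.
rewrite leq_mul2l; apply/orP; right.
have arith (u v w : nat) : (0 < v -> u <= v + w -> u.-1 <= w + v.-1)%N by lia.
by apply: arith (size_twist _ _); rewrite lt0n sizeY_eq0.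
Qed.

(** From [x + y = x * (y / x + 1)], where [x] occurs twice, whence the factor 2. *)
Lemma height_add x y : (h (x + y) <= 2 * h x + h y)%N.
Proof.
have [->|xn0] := eqVneq x 0; first by rewrite add0r leq_addl.
have -> : x + y = x * (y * x^-1 + iota 1).
  by rewrite rmorph1 mulrDr mulr1 mulrCA mulfV // mulr1 addrC.
apply: leq_trans (height_mul _ _) _; rewrite height_addC mul2n -addnn -addnA leq_add2l.
by apply: leq_trans (height_mul _ _) _; rewrite height_inv addnC.
Qed.

Lemma height_sub x y : (h (x - y) <= h x + 2 * h y)%N.
Proof. by rewrite addrC addnC; apply: leq_trans (height_add _ _) _; rewrite height_opp. Qed.

Lemma height_sum n (f : 'I_n -> K) (B : nat) :
  (forall i, (h (f i) <= B)%N) -> (h (\sum_i f i) <= n * (2 * B))%N.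
Proof.
move=> le; elim: n f le => [|n IHn] f le.
  by rewrite big_ord0 -(rmorph0 iota) height_const.
rewrite big_ord_recl; apply: leq_trans (height_add _ _) _.
rewrite [(n.+1 * _)%N]mulSn; apply: leq_add; [exact: leq_mul | by apply: IHn].
Qed.

Lemma height_exp x n : (h (x ^+ n) <= n * h x)%N.
Proof.
elim: n => [|n IHn]; first by rewrite expr0 -(rmorph1 iota) height_const.
by rewrite exprS mulSn; apply: leq_trans (height_mul _ _) _; rewrite leq_add2l.
Qed.

Lemma height_ev_le x g : (h (ev x g) <= (size g).-1 * h x)%N.
Proof.
elim/poly_ind: g => [|g c IHg]; first by rewrite rmorph0 -(rmorph0 iota) height_const.
rewrite rmorphD rmorphM /= evX evC height_addC size_MXaddC.
case: ifP => [/andP[/eqP -> _]|]; first by rewrite rmorph0 mul0r -(rmorph0 iota) height_const.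
have [->|gn0] := eqVneq g 0; first by rewrite rmorph0 mul0r -(rmorph0 iota) height_const.
move=> _ /=; apply: leq_trans (height_mul _ _) _.
by rewrite -(prednK (_ : 0 < size g)%N) ?size_poly_gt0 // mulSn addnC leq_add2l.
Qed.

Lemma height_expn x n : (0 < n)%N -> (n * h x <= h (x ^+ n))%N.
Proof. by move=> n0; have := height_ev x 'X^n; rewrite rmorphXn /= evX size_polyXn. Qed.

End Height.

(** * The derivation with respect to [t] *)

Section PthPowers.

Variables (K : fieldType) (p : nat) (pcharK : p \in [pchar K]) (t : K).
Hypothesis t_npow : ~ exists y, t = y ^+ p.
Local Notation frob := (pFrobenius_aut pcharK).
Implicit Types g : {poly K}.

Let p_gt0 : (0 < p)%N. Proof. exact: prime_gt0 (pcharf_prime pcharK). Qed.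

(* Otherwise [t] would be a simple root, so that [X - t] would be the gcd of
   [map_poly frob g] and [X^p - t^p = (X - t)^p], hence have its coefficients
   in [K^p]. *)
Lemma deriv_root_frob g : (map_poly frob g).[t] = 0 -> (map_poly frob g^`()).[t] = 0.
Proof.
rewrite -deriv_map => root_t; apply: contrapT => /eqP ndroot.
have eqQ : map_poly frob ('X^p - t%:P) = ('X - t%:P) ^+ p.
  have pcharKX : p \in [pchar {poly K}] by rewrite pchar_poly.
  rewrite -[RHS](pFrobenius_autE pcharKX) pFrobenius_autB_comm; last exact: mulrC.
  by rewrite !pFrobenius_autE rmorphB /= map_polyXn map_polyC -rmorphXn.
pose G := gcdp g ('X^p - t%:P).
have mapG : map_poly frob G = gcdp (map_poly frob g) (('X - t%:P) ^+ p).
  by rewrite gcdp_map eqQ.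
have rootG : root (map_poly frob G) t.
  by rewrite mapG -dvdp_XsubCl dvdp_gcd dvdp_XsubCl /root root_t eqxx dvdp_exp.
have /dvdp_exp_XsubCP[k le_k eqG] : map_poly frob G %| ('X - t%:P) ^+ p.
  by rewrite mapG dvdp_gcdr.
have sG : size G = 2.
  have := eqp_size eqG; rewrite size_map_poly size_exp_XsubC => ->; congr _.+1.
  case: k le_k eqG => [|[|k]] // _ eqG.
    by move: rootG; rewrite (eqp_root eqG) expr0 (negPf (root1 _)).
  have : ('X - t%:P) ^+ 2 %| map_poly frob g.
    apply: dvdp_trans (dvdp_gcdl _ (('X - t%:P) ^+ p)); rewrite -mapG (eqp_dvdr _ eqG).
    by rewrite dvdp_exp2l.
  case/dvdpP => q eqg; case/negP: ndroot.
  by rewrite eqg expr2 !derivM !hornerE !subrr /= !(mulr0, mul0r, addr0).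
have lead0 : G`_1 != 0.
  have -> : G`_1 = lead_coef G by rewrite lead_coefE sG.
  by rewrite lead_coef_eq0 -size_poly_eq0 sG.
apply: t_npow; exists (- G`_0 / G`_1).
move/rootP: rootG; rewrite horner_coef size_map_poly sG !big_ord_recl big_ord0 /=.
rewrite !coef_map /= expr0 mulr1 addr0 expr1 => /eqP; rewrite addrC addr_eq0 => /eqP eqt.
rewrite -(pFrobenius_autE pcharK) rmorphM rmorphN fmorphV /= -eqt mulrAC mulfV ?mul1r //.
by rewrite pFrobenius_autE expf_neq0.
Qed.

Lemma deriv0_const g : (size g <= p)%N -> g^`() = 0 -> g = (g`_0)%:P.
Proof.
move=> le_p dg0; apply/polyP => -[|i]; rewrite coefC //=.
have [le|lt] := leqP (size g) i.+1; first by rewrite nth_default.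
have := congr1 (fun q : {poly K} => q`_i) dg0; rewrite coef_deriv coef0 => /eqP.
rewrite -mulr_natr mulf_eq0 -(dvdn_pcharf pcharK) => /orP[/eqP//|/dvdn_leq].
by move/(_ isT); rewrite leqNgt (leq_trans lt).
Qed.

(** That is, [1, t, ..., t^(p-1)] are independent over [K^p]. The derivative of a relation is a
    shorter relation, hence zero by induction; so the relation is constant. *)
Lemma frob_poly_eq0 g : (size g <= p)%N -> (map_poly frob g).[t] = 0 -> g = 0.
Proof.
have [n] := ubnP (size g); elim: n g => // n IHn g; rewrite ltnS => le_n le_p root_t.
have [->//|gn0] := eqVneq g 0.
have dg0 : g^`() = 0.
  have lt := lt_size_deriv gn0.
  apply: IHn; [exact: leq_trans le_n|exact: leq_trans (ltnW lt) le_p|exact: deriv_root_frob].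
move: root_t; rewrite (deriv0_const le_p dg0) map_polyC hornerC /= pFrobenius_autE => /eqP.
by rewrite expf_eq0 p_gt0 => /eqP ->.
Qed.

(** An element written as a polynomial in [t] over [K^p] is sent to the formal derivative at [t];
    [deriv_root_frob] makes this independent of the way of writing it. *)
Lemma derivation_exists :
  (forall u, exists2 g : {poly K}, (size g <= p)%N & u = (map_poly frob g).[t]) ->
  exists D : K -> K, [/\ {morph D : x y / x + y}, forall x y, D (x * y) = D x * y + x * D y,
    forall w, D (w ^+ p) = 0, D t = 1 & forall y, D y = 0 -> exists w, y = w ^+ p].
Proof.
move=> gen.
have /choice[G GP] : forall u, exists g : {poly K}, (size g <= p)%N /\ u = (map_poly frob g).[t].
  by move=> u; have [g] := gen u; exists g.
pose D u := (map_poly frob (G u)^`()).[t].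
have Dh g : D (map_poly frob g).[t] = (map_poly frob g^`()).[t].
  apply/eqP; rewrite -subr_eq0 /D -hornerN -hornerD -rmorphB /= -derivB; apply/eqP.
  by apply: deriv_root_frob; rewrite rmorphB hornerD hornerN /= -(GP _).2 subrr.
have Gh u := (GP u).2.
exists D; split.
- move=> x y; rewrite {1}(Gh x) {1}(Gh y) -hornerD -rmorphD Dh derivD rmorphD.
  by rewrite hornerD.
- move=> x y; rewrite {1}(Gh x) {1}(Gh y) -hornerM -rmorphM Dh derivM rmorphD /=.
  by rewrite !rmorphM /= hornerD !hornerM -!Gh.
- move=> w; have := Dh w%:P.
  by rewrite map_polyC hornerC /= pFrobenius_autE derivC rmorph0 horner0.
- by have := Dh 'X; rewrite map_polyX hornerX derivX rmorph1 hornerC.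
move=> y Dy0; have [sg eqy] := GP y.
have dg0 : (G y)^`() = 0.
  apply: frob_poly_eq0 Dy0; have [->|gn0] := eqVneq (G y) 0; first by rewrite deriv0 size_poly0.
  by apply: leq_trans sg; apply: ltnW; apply: lt_size_deriv.
by exists (G y)`_0; rewrite {1}eqy (deriv0_const sg dg0) map_polyC hornerC coefC.
Qed.

End PthPowers.

(** A zero derivative leaves only exponents divisible by [p], and [b ^+ p] is [b] with its
    coefficients raised to the power [p], taken at [X^p]. *)
Lemma poly_pth_root (R : idomainType) (p : nat) (a : {poly R}) :
  p \in [pchar R] -> a^`() = 0 -> (forall i, exists b, a`_i = b ^+ p) ->
  exists b : {poly R}, a = b ^+ p.
Proof.
move=> pcharR da0 /choice[beta rootb].
have p_gt0 : (0 < p)%N by rewrite prime_gt0 // (pcharf_prime pcharR).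
have pcharRX : p \in [pchar {poly R}] by rewrite pchar_poly.
have powE (b : {poly R}) : b ^+ p = map_poly (pFrobenius_aut pcharR) b \Po 'X^p.
  rewrite -(pFrobenius_autE pcharRX); elim/poly_ind: b => [|b c IH].
    by rewrite !rmorph0.
  rewrite !rmorphD !rmorphM /= IH map_polyX map_polyC comp_polyX comp_polyC.
  by rewrite !pFrobenius_autE rmorphXn.
exists (\poly_(i < size a) beta (p * i)%N); rewrite powE; apply/polyP => k.
rewrite coef_comp_poly_Xn //; case: ifP => [/dvdnP[i ->]|pk].
  rewrite mulnK // coef_map coef_poly /= (mulnC i); case: ltnP => [_|le_i].
    by rewrite pFrobenius_autE rootb.
  by rewrite rmorph0 nth_default // (leq_trans le_i) // leq_pmull.
case: k pk => [|k pk]; first by rewrite dvdn0.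
have := congr1 (fun q : {poly R} => q`_k) da0; rewrite coef_deriv coef0 => /eqP.
by rewrite -mulr_natr mulf_eq0 -(dvdn_pcharf pcharR) pk orbF => /eqP.
Qed.

(** * Generation of [K] by [t] over [K^p], and heights of derivatives *)

Section Derivation.

Variables (F K : fieldType) (iota : {rmorphism F -> K}).
Implicit Types (x y z : K) (a g : {poly F}) (P Q R : {poly {poly F}}).
Local Notation ev := (ev iota).
Local Notation ev2 := (ev2 iota).
Local Notation transc := (transc iota).

Hypothesis constP : forall x, ~ transc x -> exists c, x = iota c.
Variable h : K -> nat.
Hypothesis hP : forall x, is_height iota x (h x).

Variables (p : nat) (pcharK : p \in [pchar K]).
Hypothesis perfect : forall c : F, exists d, c = d ^+ p.
Variable t : K.
Hypothesis (t_transc : transc t) (t_npow : ~ exists y, t = y ^+ p).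
Local Notation frob := (pFrobenius_aut pcharK).

Let p_prime : prime p. Proof. exact: pcharf_prime pcharK. Qed.
Let p_gt0 : (0 < p)%N. Proof. exact: prime_gt0. Qed.
Let pcharF : p \in [pchar F]. Proof. by rewrite -(fmorph_pchar iota). Qed.

(* [p + 1] elements independent over [K^p], times the p-th powers of a basis of
   [K] over [F(t)], would be too many independent elements over [F(t^p)]. *)
Lemma frob_dependent (r : 'I_p.+1 -> K) : ~ indep frob r.
Proof.
move=> indr; have [e [ind _]] := height_basis hP t_transc.
have tp : transc (t ^+ p).
  apply: (height_transc hP); apply: leq_trans _ (height_expn hP t p_gt0).
  by rewrite muln_gt0 p_gt0 (height_gt0 hP).
(* As constants are p-th powers, a polynomial in [t^p] is the p-th power of a polynomial in [t]. *)
have root a : exists b, ev (t ^+ p) a = (ev t b) ^+ p.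
  elim/poly_ind: a => [|a c [b eqb]]; first by exists 0; rewrite !rmorph0 expr0n gtn_eqF.
  have [d ->] := perfect c; exists (b * 'X + d%:P).
  rewrite !rmorphD !rmorphM /= !evX !evC eqb -!(pFrobenius_autE pcharK).
  by rewrite rmorphD rmorphM /= !pFrobenius_autE rmorphXn.
have : indep (ev (t ^+ p)) (fun ij : 'I_(h t) * 'I_p.+1 => e ij.1 ^+ p * r ij.2).
  move=> a suma; have [b eqb] := choice (fun ij => root (a ij)).
  case=> i j; rewrite eqb.
  suff b0 : forall j, \sum_i ev t (b (i, j)) * e i = 0.
    by rewrite (ind (fun i => b (i, j))) ?expr0n ?gtn_eqF.
  move=> k; suff : frob (\sum_i ev t (b (i, k)) * e i) = 0.
    by rewrite pFrobenius_autE => /eqP; rewrite expf_eq0 p_gt0 => /eqP.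
  apply: (indr (fun j => \sum_i ev t (b (i, j)) * e i)); rewrite -[RHS]suma.
  transitivity (\sum_j \sum_i ev (t ^+ p) (a (i, j)) * (e i ^+ p * r j)); last first.
    by rewrite exchange_big pair_bigA; apply: eq_bigr => -[k' l] _.
  apply: eq_bigr => l _; rewrite rmorph_sum mulr_suml; apply: eq_bigr => k' _ /=.
  by rewrite rmorphM /= !pFrobenius_autE eqb mulrA.
move/(card_le_height hP tp); rewrite card_prod !card_ord.
move/leq_trans/(_ (height_exp constP hP t p)); rewrite mulnS -[X in (_ <= X)%N]add0n mulnC.
by rewrite leq_add2r leqNgt (height_gt0 hP).
Qed.

(** By [frob_poly_eq0], a relation among [1, t, ..., t^(p-1), u] over [K^p] must involve [u], and
    can be solved for it. *)
Lemma frob_generates u : exists2 g : {poly K}, (size g <= p)%N & u = (map_poly frob g).[t].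
Proof.
pose r (i : 'I_p.+1) := if (i < p)%N then t ^+ i else u.
have [a [suma [i ai]]] : exists a : 'I_p.+1 -> K,
    \sum_i frob (a i) * r i = 0 /\ exists i, frob (a i) <> 0.
  apply: contrapT => H; apply: (@frob_dependent r) => a suma i; apply: contrapT => ai.
  by apply: H; exists a; split=> //; exists i.
pose w j : 'I_p.+1 := widen_ord (leqnSn p) j.
have sumE c : \sum_(j < p) frob (c * a (w j)) * t ^+ j
    = (map_poly frob (\poly_(j < p) (c * a (inord j)))).[t].
  rewrite (@horner_coef_wide _ p) ?size_map_poly ?size_poly //; apply: eq_bigr => j _.
  rewrite coef_map coef_poly ltn_ord /=; congr (frob (_ * a _) * _); apply: val_inj.
  by rewrite /= inordK // ltnS ltnW.
move: suma; rewrite big_ord_recr /= {2}/r ltnn.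
under eq_bigr do rewrite /r /= ltn_ord.
have [am0|amn0] := eqVneq (a ord_max) 0.
  have sum1 : \sum_(j < p) frob (a (w j)) * t ^+ j = \sum_(j < p) frob (1 * a (w j)) * t ^+ j.
    by apply: eq_bigr => j _; rewrite mul1r.
  rewrite sum1 sumE.
  rewrite am0 rmorph0 mul0r addr0 => /(frob_poly_eq0 t_npow (size_poly _ _)) g0.
  case: ai; have [lt|ge] := ltnP i p.
    have := congr1 (fun q : {poly K} => q`_i) g0; rewrite coef_poly lt mul1r inord_val coef0 => ->.
    exact: rmorph0.
  have -> : i = ord_max by apply: val_inj => /=; apply/eqP; rewrite eqn_leq ge -ltnS ltn_ord.
  by rewrite am0 rmorph0.
move=> /eqP; rewrite addrC addr_eq0 => /eqP eqam.
exists (\poly_(j < p) (- (a ord_max)^-1 * a (inord j))); first exact: size_poly.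
rewrite -sumE; apply: (@mulfI _ (frob (a ord_max))); first by rewrite fmorph_eq0.
rewrite eqam mulr_sumr -sumrN; apply: eq_bigr => j _.
by rewrite mulrA -rmorphM mulrA mulrN mulfV // mulN1r rmorphN mulNr.
Qed.

Variable D : K -> K.
Hypothesis DD : {morph D : x y / x + y}.
Hypothesis DM : forall x y, D (x * y) = D x * y + x * D y.
Hypothesis Dpow : forall w, D (w ^+ p) = 0.

Lemma D_const c : D (iota c) = 0.
Proof. by have [d ->] := perfect c; rewrite rmorphXn Dpow. Qed.

Lemma D_zero : D 0 = 0.
Proof. by rewrite -[X in D X](rmorph0 iota) D_const. Qed.

Lemma D_ev x a : D (ev x a) = ev x a^`() * D x.
Proof.
elim/poly_ind: a => [|a c IH]; first by rewrite deriv0 !rmorph0 mul0r D_zero.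
rewrite rmorphD rmorphM /= evX evC DD DM D_const IH addr0 derivD derivM derivX derivC addr0 mulr1.
by rewrite rmorphD rmorphM /= evX mulrDl mulrAC.
Qed.

(** The chain rule; the partial derivative in the inner variable is taken after a swap. *)
Lemma D_ev2 x y P : D (ev2 x y P) = ev2 x y P^`() * D y + ev2 y x (swapXY P)^`() * D x.
Proof.
elim/poly_ind: P => [|P c IH].
  by rewrite /= !raddf0 /= !mul0r addr0 D_zero.
rewrite rmorphD rmorphM /= ev2X ev2C DD DM D_ev IH !(rmorphD, rmorphM) /= swapXY_X swapXY_polyC.
rewrite !derivD !derivM derivX !derivC addr0 mulr1 mulr0 addr0 deriv_map.
rewrite -(swapXY_polyC c^`()) !rmorphD !rmorphM /= !ev2X !ev2C evX ev2_swap ev2C.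
ring.
Qed.

Lemma height_ev2_le x y P d n : (size P <= d.+1)%N -> (sizeY P <= n.+1)%N ->
  (h (ev2 x y P) <= d.+1 * (2 * (n * h x + d * h y)))%N.
Proof.
move=> sP sYP; rewrite (ev2_sum _ _ _ sP); apply: (height_sum constP hP) => i.
apply: leq_trans (height_mul constP hP _ _) _; apply: leq_add.
  apply: leq_trans (height_ev_le constP hP _ _) _; rewrite leq_mul2r; apply/orP; right.
  by have := leq_trans (max_size_coefXY P i) sYP; case: (size P`_i).
apply: leq_trans (height_exp constP hP _ _) _; rewrite leq_mul2r -ltnS.
by apply/orP; right; exact: ltn_ord.
Qed.

Hypothesis Dt : D t = 1.

(* [D u = - P_T / P_U] at [(t, u)] for a relation [P(t, u) = 0] of degree at
   most [h u] in [T] and at most [h t] in [U]: the latter bound is independent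
   of [u], so the estimate is linear in [h u]. *)
Lemma height_derivation u : (h (D u) <= 8 * (h t).+1 * h t * h u)%N.
Proof.
have [tu|/constP[c ->]] := pselect (transc u); last first.
  by rewrite D_const -(rmorph0 iota) (height_const hP).
have [P [Pn0 P0 minP [m [e [m_gt0 _ le1 le2]]]]] := height_relation hP t_transc tu.
have sP : (size P <= (h t).+1)%N.
  apply: leq_trans (leqSpred _) _; rewrite ltnS; apply: leq_trans le1; exact: leq_pmull.
have sYP : (sizeY P <= (h u).+1)%N.
  apply: leq_trans (leqSpred _) _; rewrite ltnS; apply: leq_trans le2; exact: leq_pmull.
pose R := swapXY (swapXY P)^`().
have eqD : ev2 t u P^`() * D u + ev2 t u R = 0.
  have := D_ev2 t u P; rewrite P0 D_zero Dt mulr1 => /esym.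
  by rewrite /R ev2_swap.
have sYdP : (sizeY P^`() <= sizeY P)%N.
  apply/bigmax_leqP => i _; rewrite coef_deriv; apply: leq_trans (max_size_coefXY P i.+1).
  by rewrite -scaler_nat size_scale_leq.
have sR : (size R <= size P)%N.
  rewrite -sizeYE; apply: leq_trans (_ : sizeY (swapXY P) <= _)%N; last by rewrite sizeYE swapXYK.
  apply/bigmax_leqP => i _; rewrite coef_deriv; apply: leq_trans (max_size_coefXY (swapXY P) i.+1).
  by rewrite -scaler_nat size_scale_leq.
have sYR : (sizeY R < sizeY P)%N.
  by rewrite !sizeYE swapXYK lt_size_deriv // swapXY_eq0.
(* Otherwise minimality makes both partial derivatives of [P] vanish identically, so that
   [P = Q ^+ p]. Then [Q] is a relation too, and minimality leaves it no degree in [u], against the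
   transcendence of [t]. *)
have den0 : ev2 t u P^`() != 0.
  apply/eqP => dP0; have dPU : P^`() = 0.
    by apply: contrapT => /eqP /minP/(_ dP0)[]; rewrite leqNgt lt_size_deriv.
  have R0 : R = 0.
    move: eqD; rewrite dP0 mul0r add0r => ev2R0.
    by apply: contrapT => /eqP /minP/(_ ev2R0)[_]; rewrite leqNgt sYR.
  have dPT : (swapXY P)^`() = 0 by apply/eqP; rewrite -swapXY_eq0 -/R R0.
  have pcharFX : p \in [pchar {poly F}] by rewrite pchar_poly.
  have [|Q eqPQ] := poly_pth_root pcharFX dPU.
    move=> j; apply: (poly_pth_root pcharF); last by move=> i; exact: perfect.
    apply/polyP => i; rewrite coef0 coef_deriv -coef_swapXY.
    have := congr1 (fun q : {poly {poly F}} => q`_i`_j) dPT.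
    by rewrite coef_deriv coefMn !coef0.
  have Qn0 : Q != 0 by apply: contraNneq Pn0 => Q0; rewrite eqPQ Q0 expr0n gtn_eqF.
  have Q0 : ev2 t u Q = 0.
    by move/eqP: P0; rewrite eqPQ rmorphXn expf_eq0 p_gt0 => /eqP.
  have [le_sQ _] := minP _ Qn0 Q0.
  have sQ1 : (size Q <= 1)%N.
    have := congr1 (fun q : {poly {poly F}} => (size q).-1) eqPQ; rewrite size_exp => eqs.
    have arith (v w : nat) : (v <= w -> v.-1 = w.-1 * p -> w <= 1)%N.
      by have := prime_gt1 p_prime; nia.
    exact: arith le_sQ eqs.
  have defQ := size1_polyC sQ1; move: Q0; rewrite defQ ev2C => /t_transc Q00.
  by move: Qn0; rewrite defQ Q00 eqxx.
have -> : D u = - ev2 t u R * (ev2 t u P^`())^-1.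
  by apply: (mulIf den0); rewrite mulfVK // mulrC; apply/eqP; rewrite -addr_eq0 eqD.
apply: leq_trans (height_mul constP hP _ _) _.
rewrite (height_opp hP) (height_inv constP hP).
(* Numerator and denominator each have height at most [4 * (h t).+1 * h t * h u], whence the factor
   8. *)
have leR := height_ev2_le t u (leq_trans sR sP) (leq_trans (ltnW sYR) sYP).
have leP := height_ev2_le t u
  (leq_trans (leq_trans (size_poly _ _) (leq_pred _)) sP) (leq_trans sYdP sYP).
by apply: leq_trans (leq_add leR leP) _; nia.
Qed.

End Derivation.

(** * Frobenius powers of [t] *)

Section FrobeniusPowers.

Variables (K : fieldType) (p : nat) (pcharK : p \in [pchar K]).
Implicit Types (x y z u v : K).

Let p_prime : prime p. Proof. exact: pcharf_prime pcharK. Qed.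
Let p_gt0 : (0 < p)%N. Proof. exact: prime_gt0. Qed.

Lemma exprB_pchar x y n : (x - y) ^+ (p ^ n) = x ^+ (p ^ n) - y ^+ (p ^ n).
Proof.
elim: n => [|n IH]; first by rewrite expn0 !expr1.
rewrite expnSr !exprM IH -!(pFrobenius_autE pcharK); exact: rmorphB.
Qed.

Lemma exprD_pchar x y n : (x + y) ^+ (p ^ n) = x ^+ (p ^ n) + y ^+ (p ^ n).
Proof.
elim: n => [|n IH]; first by rewrite expn0 !expr1.
rewrite expnSr !exprM IH -!(pFrobenius_autE pcharK); exact: rmorphD.
Qed.

(** The equation says that [u - x] is the [p ^ j]-th power of [u ^+ (p ^ i) - y]. The flip moves the
    Frobenius power from [y] to [x] for the same [q], so that a derivation can see [y]. *)
Lemma artin_schreier_flip (i j : nat) (x y u : K) :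
  y ^+ (p ^ j) - x = u ^+ (p ^ (i + j)) - u ->
  exists z, u = x + z ^+ (p ^ j) /\ y - x ^+ (p ^ i) = z ^+ (p ^ (i + j)) - z.
Proof.
move=> eqyx; pose z := u ^+ (p ^ i) - y; exists z.
have equ : u = x + z ^+ (p ^ j).
  have eqU : u ^+ (p ^ (i + j)) = y ^+ (p ^ j) - x + u by rewrite eqyx subrK.
  by rewrite /z exprB_pchar -exprM -expnD eqU; ring.
split=> //; rewrite addnC expnD exprM.
have -> : z ^+ (p ^ j) = u - x by rewrite equ addrC addKr.
by rewrite exprB_pchar /z; ring.
Qed.

(** A telescoping sum: [u] is the sum of the [x ^+ (q ^ l)] for [l < k], with [q = p ^ r]. *)
Lemma artin_schreier_pow r k x : exists u, x ^+ ((p ^ r) ^ k) - x = u ^+ (p ^ r) - u.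
Proof.
elim: k => [|k [u IH]].
  exists 0.
  by rewrite expn0 expr1 subrr expr0n gtn_eqF ?expn_gt0 ?p_gt0 // subrr.
exists (x ^+ ((p ^ r) ^ k) + u).
by rewrite exprD_pchar -exprM -expnSr opprD addrACA -IH addrA subrK.
Qed.

Lemma pth_root_depth r x : ~ (exists y, x = y ^+ (p ^ r)) ->
  exists j y, [/\ (j < r)%N, x = y ^+ (p ^ j) & ~ exists w, y = w ^+ p].
Proof.
elim: r => [|r IH] nroot; first by case: nroot; exists x; rewrite expn0 expr1.
have [[y eqx]|/IH[j [y [lt eqx ny]]]] := pselect (exists y, x = y ^+ (p ^ r)).
  exists r, y; split=> // -[w eqy]; apply: nroot; exists w.
  by rewrite eqx eqy -exprM -expnS.
by exists j, y; split=> //; apply: leq_trans lt _.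
Qed.

End FrobeniusPowers.

(** * Solutions of the two Artin-Schreier equations *)

Section Core.

Variables (F K : fieldType) (iota : {rmorphism F -> K}).
Local Notation transc := (transc iota).
Hypothesis constP : forall x, ~ transc x -> exists c, x = iota c.
Variable h : K -> nat.
Hypothesis hP : forall x, is_height iota x (h x).
Variables (p : nat) (pcharK : p \in [pchar K]).
Hypothesis perfect : forall c : F, exists d, c = d ^+ p.
Variable t : K.
Hypothesis (t_transc : transc t) (t_npow : ~ exists y, t = y ^+ p).
Implicit Types (x y z u v : K).

Let p_prime : prime p. Proof. exact: pcharf_prime pcharK. Qed.
Let p_gt0 : (0 < p)%N. Proof. exact: prime_gt0. Qed.
Let p_gt1 : (1 < p)%N. Proof. exact: prime_gt1. Qed.
Let ht_gt0 : (0 < h t)%N. Proof. exact: (height_gt0 hP t_transc). Qed.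

Lemma height_artin_schreier q u : (1 < q)%N -> (q * h u <= h (u ^+ q - u))%N.
Proof.
move=> q1; have := height_ev hP u ('X^q - 'X).
rewrite rmorphB rmorphXn /= !evX size_polyDl ?size_polyXn //.
by rewrite size_polyN size_polyX ltnS.
Qed.

Lemma const_of_small_height q u (B : nat) : (1 < q)%N -> (h (u ^+ q - u) <= B)%N ->
  (B < q)%N -> exists c, u = iota c.
Proof.
move=> q1 le lt; apply: (height_eq0 constP hP); have := height_artin_schreier u q1.
by case: (h u) => // n; nia.
Qed.

(** The exponent [p.+1] is chosen for [D (x ^+ p.+1) = x ^+ p * D x], which lets the two equations
    determine [x ^+ p]. *)
Definition artin_schreier_related (q : nat) (x : K) : Prop :=
  (exists u, x - t = u ^+ q - u) /\ (exists v, x ^+ p.+1 - t ^+ p.+1 = v ^+ q - v).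

(** [C] is the constant of [height_derivation], and [B] the height bound reached in
    [height_bound_nonpower]. As [r] is twice [rho], each [j < r] has [j <= rho] or [r - j < rho], so
    that [p ^ j] or [p ^ (r - j)] is at most [p ^ rho], the square root of [q]. *)
Let C := (8 * (h t).+1 * h t)%N.
Let B := (2 * C * p.+2 * h t)%N.
Let rho := (p.+1 * (B + 2 * h t))%N.
Let r := (rho + rho)%N.
Let q := (p ^ r)%N.

Let rho_lt : (p.+1 * (B + 2 * h t) < p ^ rho)%N. Proof. exact: ltn_expl. Qed.
Let q_gt1 : (1 < q)%N.
Proof. by rewrite /q /r expnD; have := rho_lt; nia. Qed.

(** Flipping both equations treats all [j] alike: powers of [t] become p-th powers, killed by [D],
    and [y ^+ p] becomes [D z' / D z]. The heights of [z] and [z'] are about [h y / q] up to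
    multiples of [h t]. *)
Lemma height_bound_nonpower y j : (j < r)%N -> (~ exists w, y = w ^+ p) ->
  artin_schreier_related q (y ^+ (p ^ j)) -> (h y <= B)%N.
Proof.
move=> lt_jr y_npow [[u equ] [v eqv]].
have [D [DD DM Dpow Dt Dker]] := derivation_exists t_npow
  (frob_generates constP hP pcharK perfect t_transc t_npow).
have lt0i : (0 < r - j)%N by rewrite subn_gt0.
have rE : (r - j + j)%N = r by rewrite subnK // ltnW.
have powE : (p.+1 * p ^ j = p ^ j * p.+1)%N by rewrite mulnC.
rewrite -exprM -powE exprM /q -rE in eqv; rewrite /q -rE in equ.
have [z [_ eqz]] := artin_schreier_flip pcharK equ.
have [z' [_ eqz']] := artin_schreier_flip pcharK eqv.
rewrite rE -/q in eqz eqz'.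
have Dpown x n : (0 < n)%N -> D (x ^+ (p ^ n)) = 0.
  by case: n => // n _; rewrite expnSr exprM Dpow.
have D0 : D 0 = 0 by apply: (addrI (D 0)); rewrite -DD !addr0.
have DN x : D (- x) = - D x.
  by apply: (addrI (D x)); rewrite -DD !subrr D0.
have q_pow : q = (p ^ r)%N by [].
have r_gt0 : (0 < r)%N by apply: leq_ltn_trans lt_jr.
have Dy : D y = - D z.
  have := congr1 D eqz; rewrite !DD !DN Dpown // oppr0 addr0 => ->.
  by rewrite q_pow Dpown // add0r.
have Dyp : y ^+ p * D y = - D z'.
  have := congr1 D eqz'; rewrite !DD !DN Dpown // oppr0 addr0 exprSr DM Dpow mul0r add0r => ->.
  by rewrite q_pow Dpown // add0r.
have Dz0 : D z != 0.
  by apply/eqP => Dz0; apply: y_npow; apply: Dker; rewrite Dy Dz0 oppr0.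
have ypE : y ^+ p = D z' * (D z)^-1.
  by apply: (mulIf Dz0); rewrite mulfVK //; apply: oppr_inj; rewrite -Dyp Dy mulrN.
have hD w : (h (D w) <= C * h w)%N.
  exact: (height_derivation constP hP pcharK perfect t_transc DD DM Dpow Dt).
have le_i : (p ^ (r - j) <= q)%N by rewrite leq_exp2l // leq_subr.
have hz : (q * h z <= h y + 2 * (q * h t))%N.
  apply: leq_trans (height_artin_schreier _ q_gt1) _; rewrite -eqz.
  apply: leq_trans (height_sub constP hP _ _) _; rewrite leq_add2l leq_mul2l /=.
  by apply: leq_trans (height_exp constP hP _ _) _; rewrite leq_mul2r le_i orbT.
have hz' : (q * h z' <= p.+1 * (h y + 2 * (q * h t)))%N.
  apply: leq_trans (height_artin_schreier _ q_gt1) _; rewrite -eqz'.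
  apply: leq_trans (height_sub constP hP _ _) _; rewrite mulnDr; apply: leq_add.
    exact: (height_exp constP hP).
  rewrite mulnCA leq_mul2l /= -exprM.
  apply: leq_trans (height_exp constP hP _ _) _.
  by rewrite -mulnA leq_mul2l /= leq_mul2r le_i orbT.
have hyp : (p * h y <= C * h z' + C * h z)%N.
  apply: leq_trans (height_expn hP y p_gt0) _; rewrite ypE.
  apply: leq_trans (height_mul constP hP _ _) _; rewrite (height_inv constP hP).
  exact: leq_add.
have q_big : (C * p.+2 <= q)%N.
  have : (C * p.+2 <= B)%N by rewrite /B; have := ht_gt0; nia.
  have : (B <= p ^ rho)%N by have := rho_lt; nia.
  have : (p ^ rho <= q)%N by rewrite leq_exp2l // leq_addr.
  by move=> l1 l2 l3; apply: leq_trans l3 (leq_trans l2 l1).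
rewrite -(leq_pmul2l (ltnW q_gt1)).
(* Since [C * p.+2 <= q], the term in [h y] on the right is at most [q * h y]; cancelling it leaves
   [(p - 1) * h y <= B]. *)
have key : (q * (p * h y) <= C * p.+2 * (h y + 2 * (q * h t)))%N.
  apply: leq_trans (_ : (C * (q * h z') + C * (q * h z) <= _)%N).
    by rewrite !(mulnCA C) -mulnDr leq_mul2l hyp orbT.
  apply: leq_trans (leq_add (leq_mul (leqnn C) hz') (leq_mul (leqnn C) hz)) _.
  by nia.
rewrite /B; move: key q_big p_gt1; move: (h y) (h t) (q) (C) => n d Q c.
clear; nia.
Qed.

(** Expanding gives [c * t^p + c^p * t + c^(p+1) = e]; as [t] is transcendental and [p > 1], the
    coefficient [c] of [t^p] is zero. *)
Lemma shift_of_const y c e : y = t + iota c -> y ^+ p.+1 - t ^+ p.+1 = iota e -> y = t.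
Proof.
move=> eqy eqe.
pose a := c *: 'X^p + (c ^+ p) *: 'X + (c ^+ p.+1 - e)%:P : {poly F}.
have a0 : a = 0.
  apply: t_transc; rewrite /a -!mul_polyC !rmorphD !rmorphM rmorphXn /= !evC !evX.
  rewrite rmorphN /= -eqe eqy !exprSr !rmorphM /= !rmorphXn /=.
  have := exprD_pchar pcharK t (iota c) 1; rewrite expn1 => ->; ring.
have := congr1 (fun b : {poly F} => b`_p) a0.
rewrite /a !coefD !coefZ coefXn coefX coefC coef0 eqxx !gtn_eqF //.
by rewrite mulr1 mulr0 !addr0 => c0; rewrite eqy c0 rmorph0 addr0.
Qed.

(** If [j <= rho], then [y ^+ (p ^ j)] is small against [q], so [u] and [v] are constants. If
    [j > rho], the flipped equation involves a small power of [t], so [z] is constant and [D y = 0],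
    which is excluded. *)
Lemma related_nonpower y j : (j < r)%N -> (~ exists w, y = w ^+ p) ->
  artin_schreier_related q (y ^+ (p ^ j)) -> j = 0%N /\ y = t.
Proof.
move=> lt_jr y_npow rel; have le_n := height_bound_nonpower lt_jr y_npow rel.
have [D [DD DM Dpow Dt Dker]] := derivation_exists t_npow
  (frob_generates constP hP pcharK perfect t_transc t_npow).
have Dpown x n : (0 < n)%N -> D (x ^+ (p ^ n)) = 0.
  by case: n => // n _; rewrite expnSr exprM Dpow.
have D0 : D 0 = 0 by apply: (addrI (D 0)); rewrite -DD !addr0.
have DN x : D (- x) = - D x.
  by apply: (addrI (D x)); rewrite -DD !subrr D0.
have Dconst c : D (iota c) = 0 by have [d ->] := perfect c; rewrite rmorphXn Dpow.
have q_split : q = (p ^ rho * p ^ rho)%N by rewrite /q /r expnD.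
have lt_rho := rho_lt.
have [[u equ] [v eqv]] := rel; have [le_j|gt_j] := leqP j rho.
  have le_pj : (p ^ j <= p ^ rho)%N by rewrite leq_exp2l.
  have hyj : (h (y ^+ (p ^ j)) <= p ^ rho * B)%N.
    by apply: leq_trans (height_exp constP hP _ _) _; exact: leq_mul.
  have [c eqc] : exists c, u = iota c.
    apply: (const_of_small_height q_gt1 (leqnn _)); rewrite -equ.
    apply: leq_ltn_trans (height_sub constP hP _ _) _; rewrite q_split.
    by move: (h (y ^+ _)) (h t) lt_rho hyj => m d; nia.
  have [e eqe] : exists e, v = iota e.
    apply: (const_of_small_height q_gt1 (leqnn _)); rewrite -eqv.
    apply: leq_ltn_trans (height_sub constP hP _ _) _; rewrite q_split.
    have := height_exp constP hP (y ^+ (p ^ j)) p.+1; have := height_exp constP hP t p.+1.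
    by move: (h (_ ^+ p.+1)) (h (_ ^+ p.+1)) (h (y ^+ _)) (h t) lt_rho hyj => m1 m2 m d; nia.
  have eqy : y ^+ (p ^ j) = t + iota (c ^+ q - c).
    by rewrite rmorphB rmorphXn /= -eqc -equ addrC subrK.
  (* For [j > 0] the left side of [eqy] has derivative 0, and the right side has derivative 1. *)
  have j0 : j = 0%N.
    apply/eqP; rewrite -leqn0 leqNgt; apply/negP => /(Dpown y) /eqP.
    by rewrite eqy DD Dt Dconst addr0 oner_eq0.
  split=> //; rewrite j0 expn0 expr1 in eqy eqv.
  by apply: (shift_of_const eqy (e := e ^+ q - e)); rewrite rmorphB rmorphXn /= -eqe.
have rE : (r - j + j)%N = r by rewrite subnK // ltnW.
rewrite /q -rE in equ; have [z [_ eqz]] := artin_schreier_flip pcharK equ.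
rewrite rE -/q in eqz.
have [c eqc] : exists c, z = iota c.
  apply: (const_of_small_height q_gt1 (leqnn _)); rewrite -eqz.
  apply: leq_ltn_trans (height_sub constP hP _ _) _; rewrite q_split.
  have le_i : (p ^ (r - j) <= p ^ rho)%N by rewrite leq_exp2l // /r; lia.
  have := leq_trans (height_exp constP hP t (p ^ (r - j))) (leq_mul le_i (leqnn _)).
  by move: (h (t ^+ _)) (h y) (h t) le_n lt_rho => m n d; nia.
case: y_npow; apply: Dker.
have i_gt0 : (0 < r - j)%N by rewrite subn_gt0.
have r_gt0 : (0 < r)%N by apply: leq_ltn_trans lt_jr.
have q_pow : q = (p ^ r)%N by [].
have := congr1 D eqz; rewrite !DD !DN Dpown // oppr0 addr0 => ->.
by rewrite q_pow Dpown // add0r eqc Dconst oppr0.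
Qed.

(** Descent on the height: a q-th root of a solution is a solution of smaller height, and a solution
    without q-th root falls under [related_nonpower]. *)
Lemma related_power x : artin_schreier_related q x -> exists k, x = t ^+ (q ^ k).
Proof.
have [n] := ubnP (h x); elim: n x => // n IHn x; rewrite ltnS => le_n rel.
(* A constant [x] would make [u], and then [t], constant. Positive height is what makes the descent
   strict. *)
have x_transc : transc x.
  apply: contrapT => /constP[c eqc]; have [[u equ] _] := rel.
  have [e eqe] : exists e, u = iota e.
    apply: (const_of_small_height q_gt1 (leqnn _)); rewrite -equ.
    apply: leq_ltn_trans (height_sub constP hP _ _) _; rewrite eqc (height_const hP) /q /r expnD.
    by have := rho_lt; nia.
  apply: (@const_not_transc _ _ iota (c - (e ^+ q - e))).
  suff -> : iota (c - (e ^+ q - e)) = t by [].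
  by rewrite !rmorphB rmorphXn /= -eqe -eqc -equ opprB addrC subrK.
have hx := height_gt0 hP x_transc.
have [[y eqx]|nroot] := pselect (exists y, x = y ^+ q).
  have qB a b : (a - b) ^+ q = a ^+ q - b ^+ q :> K by exact: exprB_pchar.
  have [||k eqy] := IHn y; last by exists k.+1; rewrite eqx eqy -exprM -expnSr.
    apply: leq_trans le_n; have := height_expn hP y (ltnW q_gt1); rewrite -eqx.
    by have := q_gt1; nia.
  (* Substituting [u ^+ q = x - t + u] and [x = y ^+ q] shows that [u - y] is a witness for [y];
     likewise for [v]. *)
  have [[u equ] [v eqv]] := rel; split; [exists (u - y)|exists (v - y ^+ p.+1)].
    rewrite qB -eqx; have -> : u ^+ q = x - t + u by rewrite equ subrK.
    by ring.
  rewrite qB -exprM mulnC exprM -eqx.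
  have -> : v ^+ q = x ^+ p.+1 - t ^+ p.+1 + v by rewrite eqv subrK.
  by ring.
have [j [y [lt_jr eqx y_npow]]] := pth_root_depth nroot.
rewrite eqx in rel; have [j0 eqy] := related_nonpower lt_jr y_npow rel.
by exists 0%N; rewrite eqx j0 eqy !expn0.
Qed.

(** Division of [s] by [r] gives [s = r * k + i], so that [t ^+ (p ^ s)] is the [p ^ i]-th power of
    the solution [t ^+ (q ^ k)]; the condition [x <> t] removes [s = 0]. *)
Theorem frobenius_powers_iff :
  exists r : nat, forall x, (exists s : nat, (0 < s)%N /\ x = t ^+ (p ^ s)) <->
    (x <> t /\ exists2 i, (i < r)%N & exists2 y,
      x = y ^+ (p ^ i) & artin_schreier_related (p ^ r) y).
Proof.
have r_gt0 : (0 < r)%N by rewrite lt0n; apply: contraTneq q_gt1 => r0; rewrite /q r0.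
exists r => x; split=> [[s [s_gt0 ->]]|[xNt [i lt_ir [y eqx rel]]]]; last first.
  have [k eqy] := related_power rel; exists (r * k + i)%N.
  have eqx' : x = t ^+ (p ^ (r * k + i)) by rewrite eqx eqy -exprM expnD expnM.
  split=> //; rewrite lt0n; apply/eqP => s0; apply: xNt.
  by rewrite eqx' s0 expn0 expr1.
split.
  (* Equality would give [p ^ s * h t <= h t] with [s > 0]. *)
  move=> eqt; have := height_expn hP t (_ : 0 < p ^ s)%N; rewrite eqt.
  rewrite expn_gt0 p_gt0 => /(_ isT); rewrite -[X in (_ <= X)%N]mul1n leq_pmul2r //.
  by rewrite leqNgt -{1}(expn0 p) ltn_exp2l // s_gt0.
exists (s %% r)%N; first by rewrite ltn_mod.
exists (t ^+ ((p ^ r) ^ (s %/ r))).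
  by rewrite -exprM -expnM -expnD mulnC -divn_eq.
split; first exact: artin_schreier_pow.
by rewrite -exprM mulnC exprM; apply: artin_schreier_pow.
Qed.

End Core.

(** * Definability *)

Section Definability.

Variable K : fieldType.
Implicit Types S T : K -> Prop.

Lemma fo_definable_ext S T : (forall x, S x <-> T x) -> fo_definable T -> fo_definable S.
Proof. by move=> E [f fP]; exists f => x; rewrite E. Qed.

Lemma fo_definable_and S T :
  fo_definable S -> fo_definable T -> fo_definable (fun x => S x /\ T x).
Proof.
by move=> [f fP] [g gP]; exists (GRing.And f g) => x /=; rewrite fP gP.
Qed.

Lemma fo_definable_exists_lt (r : nat) (S : nat -> K -> Prop) :
  (forall i, fo_definable (S i)) -> fo_definable (fun x => exists2 i, (i < r)%N & S i x).
Proof.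
move=> def; elim: r => [|r [f fP]].
  by exists (GRing.Bool false) => x; split=> // -[].
have [g gP] := def r; exists (GRing.Or f g) => x /=; rewrite fP gP; split.
  by case=> [[i lt Si]|Sr]; [exists i => //; exact: ltnW | exists r].
case=> i; rewrite ltnS leq_eqVlt => /orP[/eqP ->|lt] Si; first by right.
by left; exists i.
Qed.

Lemma fo_definable_related (p i q : nat) (t : K) :
  fo_definable (fun x => exists2 y, x = y ^+ i & artin_schreier_related p t q y).
Proof.
pose X k := GRing.Var K k.
pose AS (a : GRing.term K) k :=
  GRing.Equal a (GRing.Add (GRing.Exp (X k) q) (GRing.Opp (X k))).
pose sub (a b : GRing.term K) := GRing.Add a (GRing.Opp b).
(* Variables 0 and 1 are [x] and [y]. The two inner quantifiers have disjoint scopes and share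
   variable 2. *)
exists (GRing.Exists 1 (GRing.And (GRing.Equal (X 0%N) (GRing.Exp (X 1%N) i))
  (GRing.And (GRing.Exists 2 (AS (sub (X 1%N) (GRing.Const t)) 2%N))
    (GRing.Exists 2 (AS (sub (GRing.Exp (X 1%N) p.+1) (GRing.Const (t ^+ p.+1))) 2%N))))).
move=> x; split=> [[y [eqx [[u equ] [v eqv]]]]|[y eqx [[u equ] [v eqv]]]].
  by exists y => //; split; [exists u|exists v].
by exists y; split=> //; split; [exists u|exists v].
Qed.

Lemma fo_definable_neq (t : K) : fo_definable (fun x => x <> t).
Proof. by exists (GRing.Not (GRing.Equal (GRing.Var K 0) (GRing.Const t))). Qed.

End Definability.

(** * The constant field as a field type *)

Section Subfield.

Variables (K : fieldType) (F : {pred K}) (subF : is_subfield F).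

(** Carrying the proof as an argument gives the predicate a head on which the closure instance can
    be declared. *)
Definition subfield_pred of is_subfield F : {pred K} := F.

Lemma subfield_divring_closed : divring_closed (subfield_pred subF).
Proof. by case: subF => F1 FB FM FV; split=> // x y xF yF; exact: (FM _ _ xF (FV _ yF)). Qed.

HB.instance Definition _ :=
  GRing.isDivringClosed.Build K (subfield_pred subF) subfield_divring_closed.

Record subfield_type := SubfieldType {
  subfield_val : K; subfield_valP : subfield_val \in subfield_pred subF }.
HB.instance Definition _ := [isSub for subfield_val].
HB.instance Definition _ := [Choice of subfield_type by <:].
HB.instance Definition _ := [SubChoice_isSubIntegralDomain of subfield_type by <:].
HB.instance Definition _ := [SubIntegralDomain_isSubField of subfield_type by <:].

End Subfield.

(** * Passage from the predicate [F] to the constant field as a type *)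

Section Transfer.

Variables (K : fieldType) (F : {pred K}) (subF : is_subfield F).
Local Notation F' := (subfield_type subF).
Let inc : {rmorphism F' -> K} := \val.

Lemma subfield_lift x : x \in F -> exists c : F', x = inc c.
Proof. by move=> xF; exists (@SubfieldType _ _ subF x xF). Qed.

Lemma polyOver_lift (a : {poly K}) : a \is a polyOver F ->
  exists b : {poly F'}, a = map_poly inc b.
Proof.
move=> aF'; have /polyOverP aF : a \is a polyOver (subfield_pred subF) := aF'.
have /choice[c eqc] := fun i => subfield_lift (aF i).
exists (\poly_(i < size a) c i); apply/polyP => i.
rewrite coef_map coef_poly; case: ltnP => [_|le]; first exact: eqc.
by rewrite (nth_default _ le); exact: (esym (rmorph0 inc)).
Qed.

Lemma polyOver_map (a : {poly F'}) : map_poly inc a \is a polyOver F.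
Proof.
suff : map_poly inc a \is a polyOver (subfield_pred subF) by [].
by apply/polyOverP => i; rewrite coef_map; exact: subfield_valP.
Qed.

Lemma algebraic_of_not_transc x : ~ transc inc x -> algebraic_over F x.
Proof.
move=> ntr; apply: contrapT => nalg; apply: ntr => a a0; apply: contrapT => /eqP an0.
apply: nalg; exists (map_poly inc a); split; [|exact: polyOver_map|exact/eqP].
by rewrite map_poly_eq0.
Qed.

Lemma transc_of_transcendental x : transcendental_over F x -> transc inc x.
Proof. by move=> tx; apply: contrapT => /algebraic_of_not_transc. Qed.

Lemma generated_absorbs (z : K) (s : seq K) :
  (forall x : K, exists c : seq K, [/\ size c = size s,
     (forall i, in_rat_fun_field F z c`_i) & x = \sum_(i < size s) c`_i * s`_i]) ->
  absorbs (@id K) (ev inc z) (fun i : 'I_(size s) => s`_i).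
Proof.
move=> gen; apply: absorbs_of_fractions => x; have [c [_ cF eqx]] := gen x.
have frac i : exists ab : {poly F'} * {poly F'},
    ev inc z ab.2 != 0 /\ c`_i = ev inc z ab.1 / ev inc z ab.2.
  have [a [b [/polyOver_lift[a' ->] /polyOver_lift[b' ->] bn0 eqc]]] := cF i.
  by exists (a', b').
have [ab /all_and2[b0 eqc]] := choice frac.
pose n := size s.
exists (\prod_(i < n) (ab i).2), (fun i : 'I_n => (ab i).1 * \prod_(j < n | j != i) (ab j).2).
split; first by rewrite rmorph_prod; apply/prodf_neq0 => i _; exact: b0.
rewrite eqx mulr_sumr; apply: eq_bigr => i _.
rewrite eqc (bigD1 i) //= !rmorphM /= mulrA; congr (_ * _).
by rewrite mulrC mulrA divfK // b0.
Qed.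

(** All [c ^+ (p ^ k)] are roots of one polynomial over the prime field, so two of them agree;
    Frobenius being injective, [c = c ^+ (p ^ n)] for some [n > 0], which is a p-th power. *)
Lemma subfield_perfect (p : nat) (pcharK : p \in [pchar K]) :
  (forall c, c \in F -> algebraic_over_prime_field c) ->
  forall c : F', exists d, c = d ^+ p.
Proof.
move=> alg c; have [a [an0 a_nat root_a]] := alg (inc c) (subfield_valP c).
have roots k : root a (inc c ^+ (p ^ k)).
  elim: k => [|k IH]; first by rewrite expn0 expr1.
  have frob_a : map_poly (pFrobenius_aut pcharK) a = a.
    by apply/polyP => i; rewrite coef_map /=; have [n ->] := a_nat i; exact: pFrobenius_aut_nat.
  rewrite expnSr exprM -(pFrobenius_autE pcharK) /root -{1}frob_a horner_map /=.
  by rewrite (rootP IH) rmorph0.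
pose rs := [seq inc c ^+ (p ^ k) | k <- iota 0 (size a)].
have rs_roots : all (root a) rs by apply/allP => _ /mapP[k _ ->]; exact: roots.
have rs_nuniq : ~~ uniq rs.
  by apply/negP => /(max_poly_roots an0 rs_roots); rewrite size_map size_iota ltnn.
have [i [j [lt_ij eqij]]] : exists i j, (i < j)%N /\ inc c ^+ (p ^ i) = inc c ^+ (p ^ j).
  apply: contrapT => H; case/negP: rs_nuniq; rewrite map_inj_uniq ?iota_uniq // => i j eqij.
  have [lt|lt|//] := ltngtP i j; case: H; first by exists i, j.
  by exists j, i.
have p_gt0 : (0 < p)%N := prime_gt0 (pcharf_prime pcharK).
have eqc : inc c = inc c ^+ (p ^ (j - i)).
  have := exprB_pchar pcharK (inc c) (inc c ^+ (p ^ (j - i))) i.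
  rewrite -exprM -expnD subnK ?(ltnW lt_ij) // -eqij subrr => /eqP.
  by rewrite expf_eq0 subr_eq0 => /andP[_ /eqP].
exists (c ^+ (p ^ (j - i).-1)); apply: val_inj.
by rewrite rmorphXn rmorphXn /= -exprM -expnSr prednK ?subn_gt0.
Qed.

End Transfer.

Theorem theorem3p5 (K : fieldType) (F : {pred K}) (p : nat) (t : K) :
  prime p -> p \in [pchar K] ->
  function_field_one_var F ->
  (forall c, c \in F -> algebraic_over_prime_field c) ->
  t \notin F ->
  ~ (exists y : K, t = y ^+ p) ->
  fo_definable (fun x : K => exists s : nat, (0 < s)%N /\ x = t ^+ (p ^ s)).
Proof.
move=> _ pcharK [subF algF [z [z_transc [s gen]]]] alg_prime tNF t_npow.
pose inc : {rmorphism subfield_type subF -> K} := \val.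
have constP x : ~ transc inc x -> exists c, x = inc c.
  by move=> /algebraic_of_not_transc /algF /(subfield_lift subF).
have t_transc : transc inc t.
  apply: contrapT => /constP[c eqt]; case/negP: tNF; rewrite eqt; exact: subfield_valP.
have [h hP] := choice (height_exists (transc_of_transcendental z_transc)
  (@generated_absorbs _ _ subF _ _ gen)).
have [r iffP] := frobenius_powers_iff constP hP pcharK
  (subfield_perfect pcharK alg_prime) t_transc t_npow.
apply: fo_definable_ext iffP _; apply: fo_definable_and; first exact: fo_definable_neq.
by apply: fo_definable_exists_lt => i; exact: fo_definable_related.
Qed.
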